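(* Let $i\in\{1,2\}$ and consider the sub-Riemannian space $(SO_0(2,1)\times\mathbb R,\rho_i)$. 1. Let $(\alpha_1,\alpha_2,\alpha_3)\in\mathbb S^2$ with $\alpha_2\ne\pm1$ and $\beta\in\mathbb R$ be such that $w_i>0$, where $w_1=\sqrt{(\alpha_2+\beta)^2+\alpha_2^2-1}$, $w_2=\sqrt{\beta^2+\alpha_2^2-1}$ (so $w_i>0$ means that the expression under the root is positive). Then the $n$-th conjugate time $t^n_{\rm conj}$ along the geodesic $\gamma_i(\alpha_1,\alpha_2,\alpha_3,\beta;t)$ has the form $$t^{2m-1}_{\rm conj}=\frac{2\pi m}{w_i},\qquad t^{2m}_{\rm conj}=\frac{2x_m}{w_i},\qquad m\in\mathbb N,$$ where $\{x_1,x_2,\dots\}$ are the ascending positive roots of the equation $\tan x=x$. 2. The first conjugate loci $\mathrm{Conj}^1_i$ of $(SO_0(2,1)\times\mathbb R,\rho_i)$, $i=1,2$, are $$\mathrm{Conj}^1_1=\mathrm{Conj}^1_2=\left\{(C,v)\in SO_0(2,1)\times\mathbb R\ \middle|\ C=\begin{pmatrix}1&0&0\\0&\cos\psi&-\sin\psi\\0&\sin\psi&\cos\psi\end{pmatrix},\ \psi,v\in\mathbb R\right\}.$$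
   Context: $SO_0(2,1)=\{g\in GL(3,\mathbb R)\mid g^TJg=J,\ \det g=1,\ g_{11}>0\}$ with $J=\mathrm{diag}(-1,1,1)$. $SO_0(2,1)\times\mathbb R$ is the group of $4\times4$ block-diagonal matrices $(C,v):=\mathrm{diag}(C,e^v)$ with $C\in SO_0(2,1)$, $v\in\mathbb R$. Its Lie algebra has basis $E_1=e_{13}+e_{31}$, $E_2=e_{12}+e_{21}$, $E_3=e_{23}-e_{32}$, $E_4=e_{44}$ ($e_{ij}$ with double indices are $4\times4$ matrix units). Put $e_1=E_1$, $e_3=E_2$, $e_4=-E_3$, and $e_2=E_4-E_3$ if $i=1$, $e_2=E_4$ if $i=2$. $\rho_i$ is the left-invariant sub-Riemannian metric defined by the left-invariant distribution with value $\mathrm{span}(e_1,e_2,e_3)$ at the unit $\mathrm{Id}$ and the inner product with orthonormal basis $e_1,e_2,e_3$. The normal geodesics from $\mathrm{Id}$ parametrized by arclength are $\gamma_i(\alpha_1,\alpha_2,\alpha_3,\beta;t)=\exp(t(\alpha_1e_1+\alpha_2e_2+\alpha_3e_3+\beta e_4))\exp(-t\beta e_4)$ with $(\alpha_1,\alpha_2,\alpha_3)\in\mathbb S^2$, $\beta\in\mathbb R$. Let $\mathcal C=\mathbb S^2\times\mathbb R$ and $\mathrm{Exp}_i:\mathcal C\times\mathbb R_+\to SO_0(2,1)\times\mathbb R$, $\mathrm{Exp}_i(\lambda,t)=\gamma_i(\lambda;t)$ for $\lambda=(\alpha_1,\alpha_2,\alpha_3,\beta)$. A time $\hat t>0$ is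 a conjugate time along $\gamma_i(\lambda;\cdot)$ if the differential of $\mathrm{Exp}_i$ at $(\lambda,\hat t)$ is degenerate; the $n$-th conjugate time is the $n$-th one in ascending order. The first conjugate time $t^1_{\rm conj}$ is the infimum of all conjugate times $t>0$; if $0<t^1_{\rm conj}<\infty$, then $\gamma_i(t^1_{\rm conj})$ is the first conjugate point. $\mathrm{Conj}^1_i$ is the set of all first conjugate points along normal geodesics $\gamma_i$ starting at $\mathrm{Id}$. *)

(* Defs.v *)
(* The field of real numbers is an arbitrary MathComp-Analysis R : realType. *)
From HB Require Import structures.
From mathcomp Require Import all_boot all_order all_algebra.
From mathcomp Require Import all_classical all_reals all_analysis.

Set Implicit Arguments.
Unset Strict Implicit.
Unset Printing Implicit Defensive.

Import Order.TTheory GRing.Theory Num.Theory.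
Import numFieldNormedType.Exports.

Local Open Scope classical_set_scope.
Local Open Scope ring_scope.

Definition mxexp (R : realType) (A : 'M[R]_4) : 'M[R]_4 :=
  limn (series (fun k : nat => (k`!%:R)^-1 *: A ^+ k)).

Definition J21 (R : realType) : 'M[R]_3 :=
  diag_mx (\row_(j < 3) [:: -1; 1; 1]`_j).

Definition SO21 (R : realType) : set 'M[R]_3 :=
  [set C | C^T *m J21 R *m C = J21 R /\ \det C = 1 /\ 0 < C 0 0].

(* The element (C, v) = diag(C, e^v) of SO_0(2,1) x R. *)
Definition elt (R : realType) (C : 'M[R]_3) (v : R) : 'M[R]_4 :=
  block_mx C 0 0 (expR v)%:M.

(* The matrix units e_{ij} are numbered from 1. *)
Definition munit (R : realType) (i j : nat) : 'M[R]_4 :=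
  delta_mx (inord i.-1) (inord j.-1).

Definition E1 (R : realType) : 'M[R]_4 := munit R 1 3 + munit R 3 1.
Definition E2 (R : realType) : 'M[R]_4 := munit R 1 2 + munit R 2 1.
Definition E3 (R : realType) : 'M[R]_4 := munit R 2 3 - munit R 3 2.
Definition E4 (R : realType) : 'M[R]_4 := munit R 4 4.

(* The value of the index i in {1, 2}. *)
Variant metric := rho1 | rho2.

Definition e1 (R : realType) : 'M[R]_4 := E1 R.
Definition e2 (R : realType) (i : metric) : 'M[R]_4 :=
  match i with rho1 => E4 R - E3 R | rho2 => E4 R end.
Definition e3 (R : realType) : 'M[R]_4 := E2 R.
Definition e4 (R : realType) : 'M[R]_4 := - E3 R.

(* The normal geodesics of rho_i from Id, parametrized by arclength when
   (a1, a2, a3) is a unit vector. *)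
Definition geodesic (R : realType) (i : metric) (a1 a2 a3 b t : R) : 'M[R]_4 :=
  mxexp (t *: (a1 *: e1 R + a2 *: e2 R i + a3 *: e3 R + b *: e4 R))
  *m mxexp (- (t * b) *: e4 R).

Definition unit_sphere (R : realType) (a1 a2 a3 : R) : Prop :=
  a1 ^+ 2 + a2 ^+ 2 + a3 ^+ 2 = 1.

(* Exp_i, given by the same formula on the ambient space R^5 of S^2 x R x R_+. *)
Definition Exp (R : realType) (i : metric) (p : R * R * R * R * R) : 'M[R]_4 :=
  let: (a1, a2, a3, b, t) := p in geodesic i a1 a2 a3 b t.

(* The tangent space of S^2 x R x R_+ at a point (a1, a2, a3, b, t). *)
Definition tangent (R : realType) (a1 a2 a3 : R) : set (R * R * R * R * R) :=
  [set u | let: (u1, u2, u3, _, _) := u in a1 * u1 + a2 * u2 + a3 * u3 = 0].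

(* The differential of Exp_i on the manifold S^2 x R x R_+ is the restriction
   of the ambient differential to the tangent space; source and target both
   have dimension 4, so degenerate means having a nonzero kernel. *)
Definition degenerate (R : realType) (i : metric) (a1 a2 a3 b t : R) : Prop :=
  exists u : R * R * R * R * R,
    [/\ tangent a1 a2 a3 u, u != 0 &
        'd (@Exp R i) (a1, a2, a3, b, t) u = 0].

Definition conj_times (R : realType) (i : metric) (a1 a2 a3 b : R) : set R :=
  [set t | 0 < t /\ degenerate i a1 a2 a3 b t].

(* t is the n-th element of S in ascending order, n = 1, 2, 3, ...: exactly n
   elements of S are at most t. *)
Definition is_nth (R : realType) (S : set R) (n : nat) (t : R) : Prop :=
  S t /\ ([set s | S s /\ s <= t] #= `I_n)%card.

(* An infimum in the extended reals: +oo when there is no conjugate time. *)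
Definition first_conj_time (R : realType) (i : metric) (a1 a2 a3 b : R) :
    \bar R :=
  ereal_inf (EFin @` conj_times i a1 a2 a3 b).

Definition conj_locus (R : realType) (i : metric) : set 'M[R]_4 :=
  [set g | exists a1 a2 a3 b t : R,
     [/\ unit_sphere a1 a2 a3, 0 < t, first_conj_time i a1 a2 a3 b = t%:E &
         g = geodesic i a1 a2 a3 b t]].

Definition w_ (R : realType) (i : metric) (a2 b : R) : R :=
  match i with
  | rho1 => Num.sqrt ((a2 + b) ^+ 2 + a2 ^+ 2 - 1)
  | rho2 => Num.sqrt (b ^+ 2 + a2 ^+ 2 - 1)
  end.

(* tan is totalized by 0 at its poles; they are excluded explicitly. *)
Definition tan_roots (R : realType) : set R :=
  [set x | [/\ 0 < x, cos x != 0 & tan x = x]].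

Definition rotation (R : realType) (psi : R) : 'M[R]_3 :=
  \matrix_(i < 3, j < 3)
    (nth [::] [:: [:: 1; 0; 0];
                  [:: 0; cos psi; - sin psi];
                  [:: 0; sin psi; cos psi]] i)`_j.

Arguments SO21 : clear implicits.
Arguments conj_locus : clear implicits.
Arguments tan_roots : clear implicits.

(* Main.v *)
Require Import Defs.
From HB Require Import structures.
From mathcomp Require Import all_boot all_order all_algebra.
From mathcomp Require Import all_classical all_reals all_analysis.
From mathcomp Require Import zify ring lra.

Set Implicit Arguments.
Unset Strict Implicit.
Unset Printing Implicit Defensive.

Import Order.TTheory GRing.Theory Num.Theory.
Import numFieldNormedType.Exports.

Local Open Scope classical_set_scope.
Local Open Scope ring_scope.

(** The matrices so21mx x y z := x E1 + y E2 - z E3 span so(2,1), they satisfy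
X^3 = - s X with s = z^2 - x^2 - y^2, and they are annihilated by E4 on both
sides. Hence the exponential series collapses to the closed form

  exp (X + v E4) = 1 - E4 + F_1(s) X + F_2(s) X^2 + e^v E4    (mxexp_cexp),

where F_j(s) = sum_k (- s)^k / (2 k + j)! are the Stumpff functions: F_0, F_1
and F_2 are cos r, sin r / r and (1 - cos r) / r^2 for s = r^2, but they are
entire in s, so that the elliptic, parabolic and hyperbolic cases need no
separate treatment. Both factors of a geodesic have this form: writing q for
a2 + b (for rho1) or b (for rho2),

  gamma(t) = cexp (t a1) (t a3) (t q) (t a2) * cexp 0 0 (- t b) 0.

Differentiating the closed form gives d exp = exp * (L + dv E4), where L is the
linear map lderiv, a combination of the direction Z, of [Z, X] and of X with
Stumpff coefficients (dcexpE). On S^2 x R x R_+ the map (a, b, t) |-> (t a, t b)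
is a local diffeomorphism, so Exp_i is degenerate exactly when the differential
in the variables x = t a1, y = t a3, v = t a2, theta = t b has a kernel. Since
both factors are invertible, a kernel vector has dv = 0, therefore the same
dz = dtheta for both metrics, and L(dx, dy, dtheta) + dtheta E3 = 0
(diff_Exp_eq0). This is a 3 x 3 system with determinant

  - (x^2 + y^2) (F_3(s) - 2 F_4(s))    (lderiv_ker).

The first factor vanishes iff a2 = 1 or a2 = -1. The second one is positive for
s <= 0, and for s = (2 y)^2 it is 4 sin y (sin y - y cos y) / (2 y)^4. As
s = (t w_i)^2 when w_i > 0, the conjugate times are the t > 0 such that
y = t w_i / 2 is a zero of sin y or of sin y - y cos y. The positive zeros of
the former are the multiples of pi, those of the latter are the roots of
tan y = y, and exactly one root lies strictly between two consecutive positive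
multiples of pi, and none in (0, pi]; this is the alternating enumeration of
the first part.

For the second part, a finite positive first conjugate time forces a2^2 <> 1 (if
a2^2 = 1, every t > 0 is conjugate and the infimum is 0) and w_i > 0 (otherwise
there is no conjugate time); then it is 2 pi / w_i, the first exponential has
made a full turn in SO_0(2,1), and what remains is the rotation by - t b and the
factor e^(t a2). Conversely every angle, taken modulo 2 pi, and every v are
obtained from explicit parameters (first_conj_surj). *)

(** * Stumpff functions *)

Section Stumpff.
Variable R : realType.
Implicit Types (j k : nat) (s r : R).

Definition stumpff_coef j k : R := (-1) ^+ k / (2 * k + j)`!%:R.
Definition stumpff j s : R := limn (pseries (stumpff_coef j) s).

Lemma is_cvg_stumpff j s : cvgn (pseries (stumpff_coef j) s).
Proof.
apply: normed_cvg; rewrite /normed_series_of /=.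
apply: (@series_le_cvg _ _ (exp_coeff `|s|)) => [n|n|n|].
- exact: normr_ge0.
- by rewrite /exp_coeff /= divr_ge0 ?exprn_ge0 // ?ler0n.
- rewrite /exp_coeff /= /stumpff_coef !normrM normrX normrN1 expr1n mul1r.
  rewrite normrX mulrC normfV normr_nat ler_wpM2l ?exprn_ge0 //.
  rewrite lef_pV2 ?posrE ?ltr0n ?fact_gt0 // ler_nat.
  by apply: leq_fact; lia.
- exact: is_cvg_series_exp_coeff.
Qed.

Lemma cvg_stumpff j s : pseries (stumpff_coef j) s @ \oo --> stumpff j s.
Proof. exact: is_cvg_stumpff. Qed.

Lemma stumpff_rec j s : stumpff j s = (j`!%:R)^-1 - s * stumpff j.+2 s.
Proof.
apply: cvg_lim => //; rewrite -cvg_shiftS.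
rewrite [X in X @ _ --> _](_ : _ = fun n =>
  (j`!%:R)^-1 - s * pseries (stumpff_coef j.+2) s n).
  by apply: cvgB; [exact: cvg_cst | apply: cvgMl_tmp; exact: cvg_stumpff].
apply/funext => n; rewrite /pseries /series /= big_nat_recl //=.
rewrite /stumpff_coef muln0 add0n !expr0 mulr1 mul1r; congr (_ + _).
rewrite mulr_sumr -sumrN; apply: eq_bigr => k _.
have -> : (2 * k.+1 + j = 2 * k + j.+2)%N by lia.
by rewrite !exprS; ring.
Qed.

Lemma stumpff_at0 j : stumpff j 0 = (j`!%:R)^-1.
Proof. by rewrite stumpff_rec mul0r subr0. Qed.

(** Differentiation stays within the family: with N = 2 k + j + 2 the k-th
coefficient of the derivative is - (-1)^k (k + 1) / N!, and
- 2 (k + 1) = j - N. *)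
Lemma stumpff_diffs j k : pseries_diffs (stumpff_coef j) k =
  2^-1 * (j%:R * stumpff_coef j.+2 k - stumpff_coef j.+1 k).
Proof.
rewrite /pseries_diffs /stumpff_coef.
have -> : (2 * k.+1 + j = (2 * k + j).+2)%N by lia.
have -> : (2 * k + j.+2 = (2 * k + j).+2)%N by lia.
have -> : (2 * k + j.+1 = (2 * k + j).+1)%N by lia.
rewrite (factS (2 * k + j).+1) natrM invfM.
have : ((2 * k + j).+2)%:R != 0 :> R by rewrite pnatr_eq0.
have : ((2 * k + j).+1)`!%:R != 0 :> R by rewrite pnatr_eq0 -lt0n fact_gt0.
have -> : ((2 * k + j).+2)%:R = 2 * k%:R + j%:R + 2 :> R.
  by rewrite -!natr1 natrD natrM; ring.
have -> : k.+1%:R = k%:R + 1 :> R by rewrite natr1.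
rewrite exprS; move: (_`!%:R) ((-1) ^+ k) => F e F0 n0.
by field; rewrite F0.
Qed.

Lemma pseries_lin (a b : R^nat) (c d : R) s :
  pseries (fun k => c * a k + d * b k) s =
  fun n => c * pseries a s n + d * pseries b s n.
Proof.
apply/funext => n; rewrite /pseries /series /= !mulr_sumr -big_split /=.
by apply: eq_bigr => k _; ring.
Qed.

Lemma pseries_diffs_stumpff j s :
  pseries (pseries_diffs (stumpff_coef j)) s =
  fun n => (2^-1 * j%:R) * pseries (stumpff_coef j.+2) s n
           + (- 2^-1) * pseries (stumpff_coef j.+1) s n.
Proof.
rewrite -pseries_lin; congr pseries; apply/funext => k.
by rewrite stumpff_diffs; ring.
Qed.

Lemma is_derive_stumpff j s : is_derive s (1 : R) (stumpff j)
  (2^-1 * (j%:R * stumpff j.+2 s - stumpff j.+1 s)).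
Proof.
have cvg1 i t : cvgn (pseries (pseries_diffs (stumpff_coef i)) t).
  rewrite pseries_diffs_stumpff.
  by apply: is_cvgD; apply: is_cvgMl_tmp; exact: is_cvg_stumpff.
have -> : 2^-1 * (j%:R * stumpff j.+2 s - stumpff j.+1 s) =
  limn (pseries (pseries_diffs (stumpff_coef j)) s).
  symmetry; apply: cvg_lim => //; rewrite pseries_diffs_stumpff.
  rewrite [X in _ --> X](_ : _ = (2^-1 * j%:R) * stumpff j.+2 s
    + (- 2^-1) * stumpff j.+1 s); last by ring.
  by apply: cvgD; apply: cvgMl_tmp; exact: cvg_stumpff.
apply: (@pseries_snd_diffs _ _ (`|s| + 1)) => //.
- exact: is_cvg_stumpff.
- rewrite [X in pseries X](_ : _ = fun k =>
    (2^-1 * j%:R) * pseries_diffs (stumpff_coef j.+2) k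
    + (- 2^-1) * pseries_diffs (stumpff_coef j.+1) k).
    by rewrite pseries_lin; apply: is_cvgD; apply: is_cvgMl_tmp; exact: cvg1.
  apply/funext => k; rewrite {1}/pseries_diffs stumpff_diffs.
  by rewrite /pseries_diffs; ring.
- by rewrite (ger0_norm (addr_ge0 _ _)) // ltrDl.
Qed.

Lemma stumpff0_sq r : stumpff 0 (r ^+ 2) = cos r.
Proof.
apply: cvg_lim => //.
rewrite (_ : pseries _ _ = series (cos_coeff' r)); first exact: cvg_cos_coeff'.
apply/funext => n; apply: eq_bigr => k _ /=.
rewrite /stumpff_coef /cos_coeff' addn0 -exprM mul2n; exact: mulrAC.
Qed.

Lemma stumpff1_sq r : r * stumpff 1 (r ^+ 2) = sin r.
Proof.
symmetry; apply: (cvg_unique _ (@cvg_sin_coeff' R r)) => //.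
rewrite (_ : series _ = fun n => r * pseries (stumpff_coef 1) (r ^+ 2) n).
  by apply: cvgMl_tmp; exact: cvg_stumpff.
apply/funext => n; rewrite /pseries /series /= mulr_sumr.
apply: eq_bigr => k _.
rewrite /stumpff_coef /sin_coeff' addn1 -exprM mul2n exprS.
by rewrite -!exprnP; ring.
Qed.

Lemma stumpff1_rec s : stumpff 1 s = 1 - s * stumpff 3 s.
Proof. by rewrite stumpff_rec -[in RHS]invr1. Qed.

Lemma stumpff2_rec s : stumpff 2 s = 2^-1 - s * stumpff 4 s.
Proof. by rewrite stumpff_rec. Qed.

(** This is cos^2 + sin^2 = 1 for s = r^2 and cosh^2 - sinh^2 = 1 for s = - r^2.
Both are covered at once because the left-hand side has zero derivative. *)
Lemma stumpff_pythagoras s : s * stumpff 1 s ^+ 2 + stumpff 0 s ^+ 2 = 1.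
Proof.
pose Q (s : R) := s * stumpff 1 s ^+ 2 + stumpff 0 s ^+ 2.
have dQ (t : R) : is_derive t (1 : R) Q 0.
  have d0 := is_derive_stumpff 0 t; have d1 := is_derive_stumpff 1 t.
  rewrite /Q; apply: is_derive_eq.
  rewrite /GRing.scale /= mul0r sub0r mul1r !mulr1 (stumpff_rec 0) fact0 invr1.
  transitivity (stumpff 1 t * (stumpff 1 t - (1 - t * stumpff 3 t))).
    by field.
  by rewrite -stumpff1_rec subrr mulr0.
rewrite -/(Q s) (is_derive_0_is_cst s 0 dQ) /Q.
by rewrite !stumpff_at0 fact0 mul0r add0r invr1 expr1n.
Qed.

(** The Pythagorean identity divided by s; the division is harmless because the
case s = 0 holds by evaluation. The same applies to the next lemma. *)
Lemma stumpff1_expr2 s :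
  stumpff 1 s ^+ 2 = 2 * stumpff 2 s - s * stumpff 2 s ^+ 2.
Proof.
have [->|s0] := eqVneq s 0; first by rewrite !stumpff_at0 !factS fact0; field.
apply: (mulfI s0); have := stumpff_pythagoras s.
rewrite (stumpff_rec 0) fact0 invr1 => h.
by rewrite -[LHS](addrK ((1 - s * stumpff 2 s) ^+ 2)) h; ring.
Qed.

Lemma stumpff2_expr2 s : stumpff 2 s ^+ 2 =
  stumpff 1 s * stumpff 3 s + stumpff 3 s - 2 * stumpff 4 s.
Proof.
have [->|s0] := eqVneq s 0.
  by rewrite !stumpff_at0 !factS fact0; field.
have e1 := stumpff1_rec s; have e2 := stumpff2_rec s.
have e3 : s * stumpff 3 s = 1 - stumpff 1 s by rewrite e1; ring.
have e4 : s * stumpff 4 s = 2^-1 - stumpff 2 s by rewrite e2; ring.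
apply: (mulfI s0).
have -> : s * stumpff 2 s ^+ 2 = 2 * stumpff 2 s - stumpff 1 s ^+ 2.
  by rewrite stumpff1_expr2; ring.
rewrite (_ : s * (stumpff 1 s * stumpff 3 s + stumpff 3 s - 2 * stumpff 4 s) =
  (stumpff 1 s + 1) * (s * stumpff 3 s) - 2 * (s * stumpff 4 s)); last by ring.
by rewrite e3 e4; field.
Qed.

(** The k-th term of the series of F_3 - 2 F_4 is
(2 k + 2) (- s)^k / (2 k + 4)!, which is nonnegative for s <= 0. *)
Lemma stumpff3B4_gt0 s : s <= 0 -> 0 < stumpff 3 s - 2 * stumpff 4 s.
Proof.
move=> s_le0.
pose u k := (stumpff_coef 3 k - 2 * stumpff_coef 4 k) * s ^+ k.
have uE k : u k = (- s) ^+ k * (2 * k + 2)%:R / (2 * k + 4)`!%:R.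
  rewrite /u /stumpff_coef -[- s]mulN1r exprMn.
  have -> : (2 * k + 4 = (2 * k + 3).+1)%N by lia.
  rewrite factS natrM invfM.
  have : (2 * k + 3)`!%:R != 0 :> R by rewrite pnatr_eq0 -lt0n fact_gt0.
  have : (2 * k + 3).+1%:R != 0 :> R by rewrite pnatr_eq0.
  have -> : (2 * k + 3).+1%:R = 2 * k%:R + 4 :> R.
    by rewrite -addn1 -addnA natrD natrM.
  have -> : (2 * k + 2)%:R = 2 * k%:R + 2 :> R by rewrite natrD natrM.
  move: (_`!%:R) ((- 1) ^+ k) (s ^+ k) => F e sk n0 F0.
  by field; rewrite F0.
have u_ge0 k : 0 <= u k.
  by rewrite uE !mulr_ge0 ?invr_ge0 ?exprn_ge0 ?oppr_ge0 ?ler0n.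
have cvgu : series u @ \oo --> stumpff 3 s - 2 * stumpff 4 s.
  rewrite (_ : series u = fun n =>
    pseries (stumpff_coef 3) s n - 2 * pseries (stumpff_coef 4) s n).
    by apply: cvgB; [|apply: cvgMl_tmp]; exact: cvg_stumpff.
  apply/funext => n; rewrite /pseries /series /= mulr_sumr -sumrB.
  by apply: eq_bigr => k _; rewrite /u; ring.
rewrite -(cvg_lim (@norm_hausdorff _ _) cvgu).
apply: (@lt_le_trans _ _ (u 0%N)).
  by rewrite uE expr0 mul1r divr_gt0 // ltr0n ?fact_gt0.
apply: limr_ge; first by apply/cvg_ex; eexists; exact: cvgu.
near=> n.
have n_gt0 : (0 < n)%N by near: n; exact: nbhs_infty_gt.
rewrite /series /= -(prednK n_gt0) big_nat_recl //= lerDl sumr_ge0 //.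
Unshelve. all: by end_near.
Qed.

(** The half-angle form of r^4 (F_3 - 2 F_4) = 2 - 2 cos r - r sin r, where
r = 2 y. *)
Lemma stumpff3B4_sq (y : R) : (2 * y) ^+ 4 *
  (stumpff 3 ((2 * y) ^+ 2) - 2 * stumpff 4 ((2 * y) ^+ 2)) =
  4 * (sin y * (sin y - y * cos y)).
Proof.
set r := 2 * y; set s := r ^+ 2.
have -> : r ^+ 4 * (stumpff 3 s - 2 * stumpff 4 s) =
   s * (s * stumpff 3 s) - 2 * s * (s * stumpff 4 s) by rewrite /s; ring.
have -> : s * stumpff 3 s = 1 - stumpff 1 s by rewrite stumpff1_rec; ring.
have -> : s * stumpff 4 s = 2^-1 - stumpff 2 s by rewrite stumpff2_rec; ring.
transitivity (2 * (1 - (1 - s * stumpff 2 s)) - r * (r * stumpff 1 s)).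
  by rewrite /s; field.
have -> : 1 - s * stumpff 2 s = cos r.
  by rewrite -stumpff0_sq (stumpff_rec 0) fact0 invr1.
rewrite stumpff1_sq /r (_ : 2 * y = y *+ 2) ?mulr_natl // cos_mulr2n sin_mulr2n.
rewrite mulrBr -expr2 sin2cos2; ring.
Qed.
End Stumpff.

(** * The exponential in closed form *)

Section Matrices.
Variable R : realType.
Implicit Types x y z v s : R.

Notation F := (@stumpff R).

(** The general element x E1 + y E2 - z E3 of so(2,1), tabulated by entries so
that products can be checked coefficient by coefficient. The sign makes
so21mx 0 0 1 the infinitesimal generator of rotation. *)
Definition so21mx x y z : 'M[R]_4 := \matrix_(i < 4, j < 4)
  (nth [::] [:: [:: 0;   y;   x; 0];
                [:: y;   0; - z; 0];
                [:: x;   z;   0; 0];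
                [:: 0;   0;   0; 0]] i)`_j.

Lemma so21mxE x y z : so21mx x y z = x *: E1 R + y *: E2 R - z *: E3 R.
Proof.
apply/matrixP => i j; rewrite !mxE -!val_eqE /= !inordK //.
case: i j => -[|[|[|[|?]]]] //= ? [[|[|[|[|?]]]] //= ?]; ring.
Qed.

(** As for cross products, X Z X is a multiple of X, the factor being the polar
form of so21_sq. For Z = X this is the Cayley-Hamilton relation X^3 = - s X. *)
Lemma so21mx_polar x y z x' y' z' :
  so21mx x y z * so21mx x' y' z' * so21mx x y z =
  - (z * z' - x * x' - y * y') *: so21mx x y z.
Proof.
apply/matrixP => i j; rewrite !mxE !big_ord_recl !big_ord0 !mxE.
rewrite !big_ord_recl !big_ord0 !mxE.
case: i j => -[|[|[|[|?]]]] //= ? [[|[|[|[|?]]]] //= ?]; ring.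
Qed.

Lemma E4E : E4 R = \matrix_(i, j) ((i == 3 :> nat) && (j == 3 :> nat))%:R.
Proof. by apply/matrixP => i j; rewrite !mxE -!val_eqE /= !inordK. Qed.

Lemma E4_so21mx x y z : E4 R * so21mx x y z = 0.
Proof.
apply/matrixP => i j; rewrite E4E !mxE !big_ord_recl !big_ord0 !mxE.
case: i j => -[|[|[|[|?]]]] //= ? [[|[|[|[|?]]]] //= ?]; ring.
Qed.

Lemma so21mx_E4 x y z : so21mx x y z * E4 R = 0.
Proof.
apply/matrixP => i j; rewrite E4E !mxE !big_ord_recl !big_ord0 !mxE.
case: i j => -[|[|[|[|?]]]] //= ? [[|[|[|[|?]]]] //= ?]; ring.
Qed.

Lemma E4_idem : E4 R * E4 R = E4 R.
Proof.
apply/matrixP => i j; rewrite E4E !mxE !big_ord_recl !big_ord0 !mxE.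
case: i j => -[|[|[|[|?]]]] //= ? [[|[|[|[|?]]]] //= ?]; ring.
Qed.

(** Minus half the trace of X^2, the invariant quadratic form of so(2,1); the
nonzero eigenvalues of X are the square roots of its opposite. *)
Definition so21_sq x y z : R := z ^+ 2 - x ^+ 2 - y ^+ 2.

Definition cexp x y z v : 'M[R]_4 :=
  let s := so21_sq x y z in let X := so21mx x y z in
  1 - E4 R + F 1 s *: X + F 2 s *: (X * X) + expR v *: E4 R.

Lemma so21mx_cube x y z : so21mx x y z * so21mx x y z * so21mx x y z =
  - so21_sq x y z *: so21mx x y z.
Proof. by rewrite so21mx_polar -!expr2. Qed.

Lemma so21mx_expS x y z m :
  so21mx x y z ^+ (2 * m).+1 = (- so21_sq x y z) ^+ m *: so21mx x y z.
Proof.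
elim: m => [|m IH]; first by rewrite muln0 expr1 expr0 scale1r.
have -> : (2 * m.+1).+1 = (2 + (2 * m).+1)%N by lia.
by rewrite exprD IH expr2 -scalerAr so21mx_cube scalerA -exprSr.
Qed.

Lemma so21mx_expSS x y z m : so21mx x y z ^+ (2 * m).+2 =
  (- so21_sq x y z) ^+ m *: (so21mx x y z * so21mx x y z).
Proof. by rewrite exprS so21mx_expS scalerAr. Qed.

Lemma so21mxDE4_expr x y z v n : (so21mx x y z + v *: E4 R) ^+ n.+1 =
  so21mx x y z ^+ n.+1 + v ^+ n.+1 *: E4 R.
Proof.
elim: n => [|n IH]; first by rewrite !expr1.
rewrite exprS IH mulrDl !mulrDr -!scalerAl -!scalerAr E4_idem so21mx_E4.
rewrite (exprS _ n) [E4 R * (_ * _)]mulrA E4_so21mx mul0r !scaler0 addr0 add0r.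
by rewrite scalerA -!exprS.
Qed.

Lemma add_scale_odd (V : lmodType R) (I X W E : V) (a b c d e g : R) :
  I + a *: X + b *: W + c *: E + d *: (e *: X + g *: E) =
  I + (a + d * e) *: X + b *: W + (c + d * g) *: E.
Proof.
rewrite scalerDr !scalerA !scalerDl addrACA; congr (_ + _).
by rewrite addrAC [in RHS]addrA.
Qed.

Lemma add_scale_even (V : lmodType R) (I X W E : V) (a b c d f g : R) :
  I + a *: X + b *: W + c *: E + d *: (f *: W + g *: E) =
  I + a *: X + (b + d * f) *: W + (c + d * g) *: E.
Proof.
rewrite scalerDr !scalerA !scalerDl addrACA; congr (_ + _).
by rewrite [in RHS]addrA.
Qed.

(** By X^(2 m + 1) = (- s)^m X and X^(2 m + 2) = (- s)^m X^2, the odd terms of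
the exponential series feed F_1 and the even ones F_2; this is why the partial
sums of the latter run up to about n / 2. *)
Lemma mxexp_partial x y z v n :
  series (fun k : nat => (k`!%:R)^-1 *: (so21mx x y z + v *: E4 R) ^+ k) n.+1 =
  1 - E4 R + pseries (stumpff_coef R 1) (so21_sq x y z) n.+1./2 *: so21mx x y z
  + pseries (stumpff_coef R 2) (so21_sq x y z) n./2 *:
      (so21mx x y z * so21mx x y z)
  + series (exp_coeff v) n.+1 *: E4 R.
Proof.
elim: n => [|n IH].
  rewrite /pseries /series /= !big_nat1 !big_geq // !scale0r !addr0.
  by rewrite !expr0 /exp_coeff /= invr1 expr0 mulr1 !scale1r subrK.
rewrite seriesSr /= IH so21mxDE4_expr.
have [m n2m] : exists m, n = (2 * m)%N \/ n = (2 * m).+1.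
  by exists n./2; have := odd_double_half n; case: odd => /= <-; lia.
have e1 : ((2 * m)./2 = m)%N by lia.
have e2 : (uphalf (2 * m) = m)%N by rewrite uphalf_half; lia.
case: n2m => ->.
- rewrite /= e1 e2 so21mx_expS add_scale_odd.
  rewrite /pseries (seriesSr _ m) (seriesSr _ (2 * m).+1) /= /stumpff_coef.
  rewrite addn1 -[- so21_sq _ _ _]mulN1r exprMn /exp_coeff /=.
  by rewrite mulrA ![_^-1 * _]mulrC.
- rewrite /= e1 e2 so21mx_expSS add_scale_even.
  rewrite [pseries (stumpff_coef R 2) _ _.+1]/pseries (seriesSr _ m).
  rewrite (seriesSr _ (2 * m).+2) /= /stumpff_coef.
  rewrite addn2 -[- so21_sq _ _ _]mulN1r exprMn /exp_coeff /=.
  by rewrite mulrA ![_^-1 * _]mulrC.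
Qed.

Lemma cvg_half (T : topologicalType) (u : nat -> T) (l : T) :
  u @ \oo --> l -> (fun n => u n./2) @ \oo --> l.
Proof.
move=> ul; apply: (cvg_comp _ _ _ ul) => A [N _ NA].
exists (2 * N)%N => // n /= Nn; apply: NA => /=; lia.
Qed.

Lemma mxexp_cexp x y z v : mxexp (so21mx x y z + v *: E4 R) = cexp x y z v.
Proof.
rewrite /mxexp; set u := (X in limn (series X)).
suff cvgu : (series u n.+1 : 'M[R]_4) @[n --> \oo] --> cexp x y z v.
  by apply: cvg_lim; [exact: norm_hausdorff | rewrite -cvg_shiftS].
rewrite (funext (mxexp_partial x y z v)).
apply: cvgD; first apply: cvgD; first apply: cvgD.
- exact: cvg_cst.
- apply: cvgZr_tmp.
  have /cvg_half := @cvg_stumpff R 1 (so21_sq x y z).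
  by rewrite -cvg_shiftS.
- by apply: cvgZr_tmp; apply: cvg_half; exact: cvg_stumpff.
- apply: cvgZr_tmp; rewrite cvg_shiftS.
  have := @is_cvg_series_exp_coeff R v; exact.
Qed.

End Matrices.

(** * The logarithmic derivative of the exponential *)

Section Tangent.
Variable R : realType.
Implicit Types x y z v s : R.

Notation F := (@stumpff R).

Lemma so21mxZ (a : R) x y z :
  a *: so21mx x y z = so21mx (a * x) (a * y) (a * z).
Proof.
apply/matrixP => i j; rewrite !mxE.
case: i j => -[|[|[|[|?]]]] //= ? [[|[|[|[|?]]]] //= ?]; ring.
Qed.

Lemma so21mxD x y z x' y' z' :
  so21mx x y z + so21mx x' y' z' = so21mx (x + x') (y + y') (z + z').
Proof.
apply/matrixP => i j; rewrite !mxE.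
case: i j => -[|[|[|[|?]]]] //= ? [[|[|[|[|?]]]] //= ?]; ring.
Qed.

Lemma so21mx_bracket x y z x' y' z' :
  so21mx x' y' z' * so21mx x y z - so21mx x y z * so21mx x' y' z' =
  so21mx (z' * y - y' * z) (x' * z - z' * x) (x' * y - y' * x).
Proof.
apply/matrixP => i j; rewrite !mxE !big_ord_recl !big_ord0 !mxE.
case: i j => -[|[|[|[|?]]]] //= ? [[|[|[|[|?]]]] //= ?]; ring.
Qed.

Lemma cexpE x y z v : cexp x y z v =
  1 + F 1 (so21_sq x y z) *: so21mx x y z
    + F 2 (so21_sq x y z) *: (so21mx x y z * so21mx x y z)
    + (expR v - 1) *: E4 R.
Proof.
rewrite /cexp; move: (_ *: so21mx _ _ _) (_ *: (_ * _)) (E4 R) => A B E.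
by apply/matrixP => i j; rewrite !mxE; ring.
Qed.

Lemma cexp_mulV x y z v : cexp x y z v * cexp (- x) (- y) (- z) (- v) = 1.
Proof.
rewrite !cexpE.
have -> : so21_sq (- x) (- y) (- z) = so21_sq x y z.
  by rewrite /so21_sq !sqrrN.
have -> : so21mx (- x) (- y) (- z) = - so21mx x y z.
  by rewrite -[- so21mx _ _ _]scaleN1r so21mxZ !mulN1r.
have X3 := so21mx_cube x y z; have XE := so21mx_E4 x y z.
have EX := E4_so21mx x y z; have EE := E4_idem R.
move: X3 XE EX EE.
set s := so21_sq x y z; set X := so21mx x y z; set E := E4 R => X3 XE EX EE.
rewrite mulrNN scalerN -scaleNr; set f := F 1 s; set g := F 2 s.
have ff : f * f = 2 * g - s * g * g.
  by rewrite -expr2 stumpff1_expr2 expr2 mulrA.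
have ee : expR v * expR (- v) = 1 by rewrite expRN mulfV ?gt_eqF ?expR_gt0.
have XW : X * (X * X) = - s *: X by rewrite mulrA.
have WW : X * X * (X * X) = - s *: (X * X).
  by rewrite mulrA X3 scalerAl.
have EW : E * (X * X) = 0 by rewrite mulrA EX mul0r.
have WE : X * X * E = 0 by rewrite -mulrA XE mulr0.
rewrite !(mulrDl, mulrDr) !mul1r !mulr1 -!(scalerAl, scalerAr) !scalerA.
rewrite X3 XW WW XE EX EE EW WE !scaler0 !scalerA !addr0.
have -> : f * - f = s * g * g - 2 * g by rewrite mulrN ff opprB.
move: ee; move: (expR v) (expR (- v)) => e e' ee.
transitivity (1 + (e * e' - 1) *: E); last by rewrite ee subrr scale0r addr0.
move: (X * X) => W; apply/matrixP => i j; rewrite !mxE.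
by move: (X i j) (W i j) (E i j) => a b c; ring.
Qed.

(** The noncommutative computation behind dcexpE. X Z X = - s' X, so every
product reduces to X, Z, X^2, X Z, Z X and X X Z; comparing coefficients leaves
exactly the three quadratic relations between f, g, k, l. *)
Lemma cexp_factor (X Z E : 'M[R]_4) (s s' f g k l e v' : R) :
  X * X * X = - s *: X -> X * Z * X = - s' *: X ->
  X * E = 0 -> E * X = 0 -> E * Z = 0 -> E * E = E ->
  f ^+ 2 = 2 * g - s * g ^+ 2 -> g ^+ 2 = f * k + k - 2 * l ->
  f = 1 - s * k ->
  (s' * (k - g)) *: X + f *: Z
    + ((s' * (2 * l - k)) *: (X * X) + g *: (Z * X + X * Z)) + (v' * e) *: E =
  (1 + f *: X + g *: (X * X) + (e - 1) *: E) *
  (f *: Z + g *: (Z * X - X * Z) + (k * s') *: X + v' *: E).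
Proof.
move=> X3 XZX XE EX EZ EE ff gg f1.
pose U := X * Z; pose V := Z * X; pose XU := X * U; pose W := X * X.
have XV : X * V = - s' *: X by rewrite mulrA.
have WZ : W * Z = XU by rewrite /W -mulrA.
have WV : W * V = - s' *: W by rewrite /W /V -mulrA XV -scalerAr.
have WU : W * U = - s *: U by rewrite /W /U mulrA X3 -scalerAl.
have WX : W * X = - s *: X by [].
have WE : W * E = 0 by rewrite -mulrA XE mulr0.
have EU : E * U = 0 by rewrite mulrA EX mul0r.
have EV : E * V = 0 by rewrite mulrA EZ mul0r.
have [e1 e1E] : exists a, a = e - 1 by exists (e - 1).
have [ks ksE] : exists a, a = k * s' by exists (k * s').
have [a aE] : exists a, a = s' * (k - g) by exists (s' * (k - g)).
have [b bE] : exists b, b = s' * (2 * l - k) by exists (s' * (2 * l - k)).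
rewrite -/U -/V -/W -e1E -ksE -aE -bE.
rewrite [RHS]mulrDl [X in _ = X + _]mulrDl [X in _ = X + _ + _]mulrDl mul1r.
rewrite -!scalerAl !mulrDr -!(scalerAr, scalerAl).
rewrite !mulrBr -/W -/U -/XU XV WZ WV WU WX WE XE EX EZ EU EV EE.
rewrite !(subrr, scaler0, addr0, add0r).
move: {XV WZ WV WU WX WE EU EV} (W) (U) (V) (XU) => W1 U1 V1 XU1.
apply/matrixP => i j; rewrite !mxE.
move: (X i j) (Z i j) (W1 i j) (U1 i j) (V1 i j) (XU1 i j) (E i j).
move=> x z w u v xu t; rewrite e1E ksE aE bE.
apply/eqP; rewrite -subr_eq0; apply/eqP.
(* The coefficients of X Z, X^2 and X each differ by one of the relations. *)
transitivity (- u * (f ^+ 2 - (2 * g - s * g ^+ 2))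
  + s' * w * (g ^+ 2 - (f * k + k - 2 * l)) + s' * g * x * (f - (1 - s * k))).
  ring.
by rewrite ff gg -f1 !subrr !mulr0 !addr0.
Qed.

(** The differential of cexp by the product rule: 2^-1 (F_3 - F_2) and
2^-1 (2 F_4 - F_3) are the derivatives of F_1 and F_2, and Z is the
direction. *)
Definition dcexp x y z v x' y' z' v' : 'M[R]_4 :=
  let s := so21_sq x y z in let s' := 2 * (z * z' - x * x' - y * y') in
  let X := so21mx x y z in let Z := so21mx x' y' z' in
  (s' * (2^-1 * (F 3 s - F 2 s))) *: X + F 1 s *: Z
  + ((s' * (2^-1 * (2 * F 4 s - F 3 s))) *: (X * X) + F 2 s *: (Z * X + X * Z))
  + (v' * expR v) *: E4 R.

(** The integral over u in [0, 1] of exp (- u ad X) Z. Its series sums up to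
Z - F_2 [X, Z] + F_3 [X, [X, Z]], and the double bracket is a combination of Z
and X. *)
Definition lderiv x y z x' y' z' : 'M[R]_4 :=
  let s := so21_sq x y z in
  let X := so21mx x y z in let Z := so21mx x' y' z' in
  F 1 s *: Z + F 2 s *: (Z * X - X * Z)
  + (F 3 s * (z * z' - x * x' - y * y')) *: X.

Lemma dcexpE x y z v x' y' z' v' : dcexp x y z v x' y' z' v' =
  cexp x y z v * (lderiv x y z x' y' z' + v' *: E4 R).
Proof.
have half2 (a b : R) : 2 * a * (2^-1 * b) = a * b.
  by rewrite mulrACA divff ?mul1r // pnatr_eq0.
rewrite cexpE /dcexp /lderiv !half2; apply: cexp_factor.
- exact: so21mx_cube.
- exact: so21mx_polar.
- exact: so21mx_E4.
- exact: E4_so21mx.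
- exact: E4_so21mx.
- exact: E4_idem.
- exact: stumpff1_expr2.
- exact: stumpff2_expr2.
- exact: stumpff1_rec.
Qed.

End Tangent.

(** * The kernel of the linearised system *)

Section Kernel.
Variable R : realType.
Implicit Types x y z v s : R.

Notation F := (@stumpff R).

Lemma lderivE x y z x' y' z' (s := so21_sq x y z)
    (t := z * z' - x * x' - y * y') :
  lderiv x y z x' y' z' = so21mx
    (F 1 s * x' + F 2 s * (z' * y - y' * z) + F 3 s * t * x)
    (F 1 s * y' + F 2 s * (x' * z - z' * x) + F 3 s * t * y)
    (F 1 s * z' + F 2 s * (x' * y - y' * x) + F 3 s * t * z).
Proof. by rewrite /lderiv so21mx_bracket !so21mxZ !so21mxD. Qed.

Lemma so21mx_inj x y z v x' y' z' v' :
  so21mx x y z + v *: E4 R = so21mx x' y' z' + v' *: E4 R ->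
  [/\ x = x', y = y', z = z' & v = v'].
Proof.
rewrite E4E => /matrixP e.
have := e (inord 0) (inord 2); have := e (inord 0) (inord 1).
have := e (inord 2) (inord 1); have := e (inord 3) (inord 3).
by rewrite !mxE !inordK //= !mulr0 !mulr1 !add0r !addr0.
Qed.

Lemma det_mx33 (A : 'M[R]_3) : let a i j := A (inord i) (inord j) in
  \det A = a 0%N 0%N * (a 1%N 1%N * a 2%N 2%N - a 1%N 2%N * a 2%N 1%N)
         - a 0%N 1%N * (a 1%N 0%N * a 2%N 2%N - a 1%N 2%N * a 2%N 0%N)
         + a 0%N 2%N * (a 1%N 0%N * a 2%N 1%N - a 1%N 1%N * a 2%N 0%N).
Proof.
move=> a; have aE i j : A i j = a i j by rewrite /a !inord_val.
rewrite (expand_det_row _ ord0) !big_ord_recl big_ord0 /cofactor.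
rewrite !(expand_det_row _ ord0) !big_ord_recl !big_ord0 /cofactor !det_mx11.
by rewrite !mxE !aE /= /bump /=; ring.
Qed.

(** The determinant is - (x^2 + y^2) (F_2^2 - F_1 F_3) (F_1 + s F_3) and
F_1 + s F_3 = 1, while F_2^2 - F_1 F_3 = F_3 - 2 F_4. *)
Lemma lderiv_ker x y z (s := so21_sq x y z) :
  (exists x' y' z', (x', y', z') != 0 /\
     lderiv x y z x' y' z' = so21mx 0 0 z') <->
  (x ^+ 2 + y ^+ 2) * (F 3 s - 2 * F 4 s) = 0.
Proof.
set f := F 1 s; set g := F 2 s; set k := F 3 s.
(* Column j is the j-th equation, row i collects the coefficients of the i-th
   unknown, as solutions are row vectors on the left. *)
pose M : 'M[R]_3 := \matrix_(i, j) (nth [::]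
  [:: [:: f - k * x * x; g * z - k * x * y; g * y - k * x * z];
      [:: - g * z - k * y * x; f - k * y * y; - g * x - k * y * z];
      [:: g * y + k * z * x; - g * x + k * z * y; f + k * z * z - 1]] i)`_j.
have detM : \det M = - ((x ^+ 2 + y ^+ 2) * (k - 2 * F 4 s)).
  have e1 := stumpff1_rec s; have e2 := stumpff2_expr2 s.
  have -> : k - 2 * F 4 s = g ^+ 2 - f * k by rewrite e2 -/f -/k; ring.
  rewrite det_mx33 !mxE !inordK //=.
  by move: e1; rewrite -/f -/k => ->; rewrite /s /so21_sq; ring.
have kerM x' y' z' :
    (\row_j [:: x'; y'; z']`_j *m M == 0) =
    (lderiv x y z x' y' z' == so21mx 0 0 z').
  rewrite lderivE -/s -/f -/g -/k; set t := _ - _ - _.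
  apply/eqP/eqP => [/matrixP e|e].
    have {}e (j : 'I_3) : \sum_i (\row_i [:: x'; y'; z']`_i) 0 i * M i j = 0.
      by have := e 0 j; rewrite !mxE.
    have := e (inord 0); have := e (inord 1); have := e (inord 2).
    rewrite !big_ord_recl !big_ord0 !mxE /= !inordK //= => e3 e2 e1.
    congr so21mx.
    - by rewrite -e1 /t; ring.
    - by rewrite -e2 /t; ring.
    - by apply/eqP; rewrite -subr_eq0; apply/eqP; rewrite -e3 /t; ring.
  have [e1 e2 e3 _] : [/\ f * x' + g * (z' * y - y' * z) + k * t * x = 0,
      f * y' + g * (x' * z - z' * x) + k * t * y = 0,
      f * z' + g * (x' * y - y' * x) + k * t * z = z' & 0 = 0 :> R].
    by apply: so21mx_inj; rewrite e.
  apply/matrixP => i j; rewrite !mxE !big_ord_recl !big_ord0 !mxE /=.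
  case: j => -[|[|[|?]]] //= ?.
  - by rewrite -[RHS]e1 /t; ring.
  - by rewrite -[RHS]e2 /t; ring.
  - by rewrite -(subrr z') -{3}e3 /t; ring.
transitivity (\det M = 0); last first.
  by rewrite detM; split => [/eqP|->]; rewrite ?oppr0 // oppr_eq0 => /eqP.
split=> [[x' [y' [z' [n0 /eqP e]]]]|/eqP/det0P[u u0 uM]].
  apply/eqP/det0P; exists (\row_j [:: x'; y'; z']`_j);
    last by apply/eqP; rewrite kerM.
  apply: contraNneq n0 => /matrixP u0.
  have := u0 0 (inord 0); have := u0 0 (inord 1); have := u0 0 (inord 2).
  by rewrite !mxE !inordK //= => -> -> ->.
have uE : u = \row_j [:: u 0 (inord 0); u 0 (inord 1); u 0 (inord 2)]`_j.
  apply/matrixP => i j; rewrite ord1 mxE; case: j => -[|[|[|?]]] //= hj;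
  by congr (u 0 _); apply/val_inj; rewrite /= inordK.
exists (u 0 (inord 0)), (u 0 (inord 1)), (u 0 (inord 2)); split.
  apply: contraNneq u0 => -[a b c]; rewrite uE a b c.
  by apply/eqP/matrixP => i j; rewrite !mxE; case: j => -[|[|[|?]]].
by apply/eqP; rewrite -kerM -uE; apply/eqP.
Qed.
End Kernel.

(** * Differentials of matrix-valued maps *)

Section DirDiff.
Variables (R : realType) (V : normedModType R) (p u : V).
Implicit Types (c d : V -> R) (A B : V -> 'M[R]_4).

Notation F := (@stumpff R).

(** Differentiability at p together with the value of the differential on the
fixed vector u, so that directional derivatives can be computed by rules while
Frechet differentiability is carried along. *)
Definition has_diff c (dc : R) := differentiable c p /\ 'd c p u = dc.

Lemma has_diff_cst (a : R) : has_diff (fun=> a) 0.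
Proof. by split; [exact: differentiable_cst | rewrite diff_cst]. Qed.

Lemma has_diffD c d dc dd : has_diff c dc -> has_diff d dd ->
  has_diff (fun q => c q + d q) (dc + dd).
Proof.
move=> [hc <-] [hd <-]; split; first exact: differentiableD.
by rewrite [LHS](congr1 (@^~ u) (diffD hc hd)).
Qed.

Lemma has_diffM c d dc dd : has_diff c dc -> has_diff d dd ->
  has_diff (fun q => c q * d q) (c p * dd + d p * dc).
Proof.
move=> [hc <-] [hd <-]; split; first exact: differentiableM.
by rewrite [LHS](congr1 (@^~ u) (diffM hc hd)).
Qed.

Lemma has_diff_eq c dc dc' : has_diff c dc -> dc = dc' -> has_diff c dc'.
Proof. by move=> h <-. Qed.

Lemma has_diff_comp c dc (phi : R -> R) (dphi : R) : has_diff c dc ->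
  is_derive (c p) 1 phi dphi -> has_diff (fun q => phi (c q)) (dc * dphi).
Proof.
move=> [hc <-] [hphi dphiE].
have hp : differentiable phi (c p) by apply/derivable1_diffP.
split; first exact: (differentiable_comp hc).
rewrite [LHS](congr1 (@^~ u) (diff_comp hc hp)) /= diff1E //.
by rewrite derive1E dphiE.
Qed.

Definition has_mxdiff A (dA : 'M[R]_4) :=
  forall i j, has_diff (fun q => A q i j) (dA i j).

(** A is the sum of its entries times the constant matrix units, and the entries
of its differential are recovered by composing with the coordinate maps. *)
Lemma has_mxdiff_diff A dA : has_mxdiff A dA ->
  differentiable A p /\ 'd A p u = dA.
Proof.
move=> hA; have dfA : differentiable A p.
  have -> : A = \sum_i \sum_j (fun q => A q i j *: delta_mx i j).
    apply/funext => q; rewrite {1}[A q]matrix_sum_delta fct_sumE.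
    by apply: eq_bigr => i _; rewrite fct_sumE.
  apply: differentiable_sum => i; apply: differentiable_sum => j.
  by apply: differentiableZl; have [] := hA i j.
split=> //; apply/matrixP => i j; have [_ <-] := hA i j.
have @f : {linear 'M[R]_4 -> R}.
  by exists (fun N : 'M[R]_(_, _) => N i j); do 2![eexists]; do ?[constructor];
     rewrite ?mxE// => ? *; rewrite ?mxE//; move=> ?; rewrite !mxE.
have fc : continuous f by exact: coord_continuous.
have -> : (fun q => A q i j) = f \o A by [].
rewrite [RHS](congr1 (@^~ u) (diff_comp dfA (linear_differentiable _ fc))).
exact: esym (congr1 (@^~ ('d A p u)) (diff_lin (A p) fc)).
Qed.

Lemma has_mxdiff_cst (A : 'M[R]_4) : has_mxdiff (fun=> A) 0.
Proof. by move=> i j; rewrite mxE; exact: has_diff_cst. Qed.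

Lemma has_mxdiffD A B dA dB : has_mxdiff A dA -> has_mxdiff B dB ->
  has_mxdiff (fun q => A q + B q) (dA + dB).
Proof.
move=> hA hB i j; rewrite mxE.
rewrite (_ : (fun _ => _) = fun q => A q i j + B q i j).
  exact: has_diffD.
by apply/funext => q; rewrite mxE.
Qed.

Lemma has_mxdiffZ c A dc dA : has_diff c dc -> has_mxdiff A dA ->
  has_mxdiff (fun q => c q *: A q) (dc *: A p + c p *: dA).
Proof.
move=> hc hA i j; rewrite !mxE.
rewrite (_ : (fun _ => _) = fun q => c q * A q i j).
  by apply: has_diff_eq (has_diffM hc (hA i j)) _; ring.
by apply/funext => q; rewrite mxE.
Qed.

Lemma has_diff_sum n (c : 'I_n -> V -> R) (dc : 'I_n -> R) :
  (forall i, has_diff (c i) (dc i)) ->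
  has_diff (fun q => \sum_i c i q) (\sum_i dc i).
Proof.
elim: n c dc => [|n IH] c dc h.
  rewrite big_ord0 (_ : (fun _ => _) = fun=> 0); first exact: has_diff_cst.
  by apply/funext => q; rewrite big_ord0.
rewrite big_ord_recl.
rewrite (_ : (fun _ => _) = fun q => c ord0 q + \sum_i c (lift ord0 i) q).
  by apply: has_diffD => //; apply: IH => i.
by apply/funext => q; rewrite big_ord_recl.
Qed.

Lemma has_mxdiffM A B dA dB : has_mxdiff A dA -> has_mxdiff B dB ->
  has_mxdiff (fun q => A q * B q) (dA * B p + A p * dB).
Proof.
move=> hA hB i j; rewrite !mxE -big_split /=.
rewrite (_ : (fun _ => _) = fun q => \sum_k A q i k * B q k j).
  apply: has_diff_sum => k.
  by apply: has_diff_eq (has_diffM (hA i k) (hB k j)) _; ring.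
by apply/funext => q; rewrite mxE.
Qed.

Lemma has_diffN c dc : has_diff c dc -> has_diff (fun q => - c q) (- dc).
Proof.
move=> [hc <-]; split; first exact: differentiableN.
by rewrite [LHS](congr1 (@^~ u) (diffN hc)).
Qed.

Lemma has_mxdiff_so21mx (x y z : V -> R) dx dy dz :
  has_diff x dx -> has_diff y dy -> has_diff z dz ->
  has_mxdiff (fun q => so21mx (x q) (y q) (z q)) (so21mx dx dy dz).
Proof.
move=> hx hy hz i j; rewrite mxE; under eq_fun do rewrite mxE.
have h0 := has_diff_cst 0; have hNz := has_diffN hz.
by case: i j => -[|[|[|[|?]]]] //= ? [[|[|[|[|?]]]] //= ?].
Qed.

Lemma has_mxdiff_cexp (x y z v : V -> R) dx dy dz dv :
  has_diff x dx -> has_diff y dy -> has_diff z dz -> has_diff v dv ->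
  has_mxdiff (fun q => cexp (x q) (y q) (z q) (v q))
    (cexp (x p) (y p) (z p) (v p) *
       (lderiv (x p) (y p) (z p) dx dy dz + dv *: E4 R)).
Proof.
move=> hx hy hz hv; rewrite -dcexpE.
have hs : has_diff (fun q => so21_sq (x q) (y q) (z q))
    (2 * (z p * dz - x p * dx - y p * dy)).
  apply: has_diff_eq.
    apply: has_diffD; first apply: has_diffD; last 2 first.
    - apply: has_diffN; exact: (has_diffM hx hx).
    - apply: has_diffN; exact: (has_diffM hy hy).
    exact: (has_diffM hz hz).
  by ring.
have hX := has_mxdiff_so21mx hx hy hz.
have hf := has_diff_comp hs (is_derive_stumpff 1 _).
have hg := has_diff_comp hs (is_derive_stumpff 2 _).
have he := has_diff_comp hv (is_derive_expR _).
have h := has_mxdiffD (has_mxdiffD (has_mxdiffD (has_mxdiff_cst (1 - E4 R))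
  (has_mxdiffZ hf hX)) (has_mxdiffZ hg (has_mxdiffM hX hX)))
  (has_mxdiffZ he (has_mxdiff_cst (E4 R))).
move=> i j; apply: has_diff_eq (h i j) _.
by rewrite add0r scaler0 addr0 mul1r.
Qed.

End DirDiff.

(** * The degeneracy criterion *)

Section Geodesics.
Variable R : realType.
Implicit Types (i : metric) (a b t x y z v s : R).

Notation F := (@stumpff R).

(** The coefficient of e4 in the velocity a1 e1 + a2 e2 + a3 e3 + b e4 once e2
is split into E4 and its so(2,1) part; only here do the two metrics differ. *)
Definition so2_speed i a2 b : R := match i with rho1 => a2 + b | rho2 => b end.

Lemma geodesicE i a1 a2 a3 b t : geodesic i a1 a2 a3 b t =
  cexp (t * a1) (t * a3) (t * so2_speed i a2 b) (t * a2)
  * cexp 0 0 (- (t * b)) 0.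
Proof.
rewrite /geodesic -!mxexp_cexp !so21mxE /e1 /e3 /e4 mulmxE.
congr (mxexp _ * mxexp _); last first.
  by rewrite !scale0r !add0r addr0 scalerN.
rewrite /so2_speed /e2; move: (E1 R) (E2 R) (E3 R) (E4 R) => X1 X2 X3 X4.
by apply/matrixP => k l; case: i; rewrite !mxE; ring.
Qed.

Lemma so21_sq_speed i a1 a2 a3 b t : unit_sphere a1 a2 a3 ->
  so21_sq (t * a1) (t * a3) (t * so2_speed i a2 b) =
  t ^+ 2 * (so2_speed i a2 b ^+ 2 + a2 ^+ 2 - 1).
Proof. by rewrite /unit_sphere /so21_sq => <-; ring. Qed.

Lemma so21mx0 : so21mx 0 0 0 = 0 :> 'M[R]_4.
Proof. by rewrite so21mxE !scale0r subr0 addr0. Qed.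

Lemma cexp_unit x y z v : cexp x y z v \is a GRing.unit.
Proof.
apply/unitrP; exists (cexp (- x) (- y) (- z) (- v)); split.
  by rewrite -[x in X in _ * X]opprK -{2}[y]opprK -{2}[z]opprK -{2}[v]opprK
     cexp_mulV.
by rewrite cexp_mulV.
Qed.

Lemma lderiv_so2 z z' : lderiv 0 0 z 0 0 z' = so21mx 0 0 z'.
Proof.
rewrite lderivE; congr so21mx; rewrite ?(mulr0, mul0r, subrr, addr0) //.
rewrite subr0 stumpff1_rec /so21_sq expr0n !subr0 /=; ring.
Qed.

Lemma so2_cexp_comm z z' :
  so21mx 0 0 z' * cexp 0 0 z 0 = cexp 0 0 z 0 * so21mx 0 0 z'.
Proof.
have c : so21mx 0 0 z' * so21mx 0 0 z = so21mx 0 0 z * so21mx 0 0 z'.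
  apply/eqP; rewrite -subr_eq0; apply/eqP; rewrite so21mx_bracket.
  rewrite !(mulr0, mul0r, subrr).
  by apply/matrixP => i j; rewrite !mxE oppr0;
    case: i j => -[|[|[|[|?]]]] //= ? [[|[|[|[|?]]]]].
rewrite cexpE expR0 subrr scale0r addr0 !mulrDr !mulrDl mulr1 mul1r.
rewrite -!scalerAr -!scalerAl c; congr (_ + _ *: _).
by rewrite mulrA c -!mulrA c.
Qed.

Lemma has_diff_fst (V W : normedModType R) (p u : V * W) (c : V -> R) dc :
  has_diff p.1 u.1 c dc -> has_diff p u (fun q => c q.1) dc.
Proof.
move=> [hc <-].
have fc : continuous (fst : {linear (V * W)%type -> V})
  by move=> q; exact: cvg_fst.
split.
  apply: (@differentiable_comp _ _ _ _ fst) => //.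
  exact: (linear_differentiable _ fc).
rewrite [LHS](congr1 (@^~ u) (diff_comp (linear_differentiable p fc) hc)) /=.
by rewrite (congr1 (@^~ u) (diff_lin p fc)).
Qed.

Lemma has_diff_snd (V : normedModType R) (p u : V * R) :
  has_diff p u (fun q => q.2) u.2.
Proof.
have fc : continuous (snd : {linear (V * R)%type -> R^o})
  by move=> q; exact: cvg_snd.
split; first exact: (linear_differentiable _ fc).
by rewrite (congr1 (@^~ u) (diff_lin p fc)).
Qed.

Lemma has_diff_id (p u : R) : has_diff p u id u.
Proof.
have fc : continuous (idfun : {linear R^o -> R^o}) by move=> q; exact: cvg_id.
split; first exact: (linear_differentiable _ fc).
exact: (congr1 (@^~ u) (diff_lin p fc)).
Qed.

(** The differential is A (L + dv E4 - dtheta so21mx 0 0 1) B with A and B the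
two invertible exponentials: the rotation B commutes with its generator, so
both contributions can be collected between A and B. The metrics enter through
dz, which differs from dtheta by a multiple of dv only. *)
Lemma diff_Exp_eq0 i a1 a2 a3 b t (u1 u2 u3 u4 u5 : R) :
  'd (@Exp R i) (a1, a2, a3, b, t) (u1, u2, u3, u4, u5) = 0 <->
  t * u2 + u5 * a2 = 0 /\
  lderiv (t * a1) (t * a3) (t * so2_speed i a2 b)
    (t * u1 + u5 * a1) (t * u3 + u5 * a3) (t * u4 + u5 * b) =
  so21mx 0 0 (t * u4 + u5 * b).
Proof.
set p := (a1, a2, a3, b, t); set u := (u1, u2, u3, u4, u5).
have d5 : has_diff p u (fun q => q.2) u5 by exact: has_diff_snd.
have d4 : has_diff p u (fun q => q.1.2) u4.
  by apply: (@has_diff_fst _ _ p u snd); exact: has_diff_snd.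
have d3 : has_diff p u (fun q => q.1.1.2) u3.
  apply: (@has_diff_fst _ _ p u (fun q => q.1.2)).
  by apply: (@has_diff_fst _ _ p.1 u.1 snd); exact: has_diff_snd.
have d2 : has_diff p u (fun q => q.1.1.1.2) u2.
  apply: (@has_diff_fst _ _ p u (fun q => q.1.1.2)).
  apply: (@has_diff_fst _ _ p.1 u.1 (fun q => q.1.2)).
  by apply: (@has_diff_fst _ _ p.1.1 u.1.1 snd); exact: has_diff_snd.
have d1 : has_diff p u (fun q => q.1.1.1.1) u1.
  apply: (@has_diff_fst _ _ p u (fun q => q.1.1.1)).
  apply: (@has_diff_fst _ _ p.1 u.1 (fun q => q.1.1)).
  apply: (@has_diff_fst _ _ p.1.1 u.1.1 (fun q => q.1)).
  by apply: (@has_diff_fst _ _ p.1.1.1 u.1.1.1 id); exact: has_diff_id.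
have ds : has_diff p u (fun q => so2_speed i q.1.1.1.2 q.1.2)
    (so2_speed i u2 u4).
  by case: i => //=; exact: has_diffD.
have d0 := has_diff_cst p u (0 : R).
have dA := has_mxdiff_cexp (has_diffM d5 d1) (has_diffM d5 d3)
  (has_diffM d5 ds) (has_diffM d5 d2).
have dB := has_mxdiff_cexp d0 d0 (has_diffN (has_diffM d5 d4)) d0.
have [_] := has_mxdiff_diff (has_mxdiffM dA dB).
rewrite (_ : (fun q : R * R * R * R * R => _ * _) = Exp i); last first.
  by apply/funext => -[[[[? ?] ?] ?] ?]; rewrite /= geodesicE.
move=> ->; rewrite scale0r addr0 lderiv_so2 -so2_cexp_comm /= ![_ * u5]mulrC.
set A := cexp (t * a1) _ _ _; set B := cexp 0 _ _ _.
set dv := t * u2 + u5 * a2; set dtheta := t * u4 + u5 * b.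
set dz := _ + _ * so2_speed _ _ _.
set L := lderiv _ _ _ _ _ dz; set S := so21mx _ _ (- _).
have -> : (A * (L + dv *: E4 R) * B + A * (S * B) = 0) <->
    (L + S + dv *: E4 R = 0).
  have -> : A * (L + dv *: E4 R) * B + A * (S * B) =
      A * (L + S + dv *: E4 R) * B.
    by rewrite [A * (S * B)]mulrA -mulrDl -mulrDr addrAC.
  split=> [e|->]; last by rewrite mulr0 mul0r.
  apply: (mulrI (cexp_unit _ _ _ _)); apply: (mulIr (cexp_unit _ _ _ _)).
  by rewrite mulr0 mul0r; exact: e.
(* For rho1 the difference dz - dtheta is dv, for rho2 it is 0. *)
have dzE : dv = 0 -> dz = dtheta.
  rewrite /dv /dz /dtheta => dv0; case: (i) => //=.
  by rewrite -[RHS]add0r -dv0; ring.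
have -> : (L + S + dv *: E4 R = 0) <-> (dv = 0 /\ L = - S).
  split=> [e|[-> ->]]; last by rewrite addNr scale0r addr0.
  have [l1 [l2 [l3 LS]]] : exists x y z, L + S = so21mx x y z.
    by do 3 eexists; rewrite /L lderivE /S so21mxD.
  have [_ _ _ dv0] : [/\ l1 = 0, l2 = 0, l3 = 0 & dv = 0].
    by apply: so21mx_inj; rewrite -LS e so21mx0 scale0r addr0.
  split=> //; apply/eqP; rewrite -addr_eq0.
  by move: e; rewrite dv0 scale0r addr0 => ->.
have -> : - S = so21mx 0 0 dtheta.
  by rewrite -[- S]scaleN1r so21mxZ !mulr0 mulN1r opprK.
by rewrite /L; split=> -[/[dup] dv0 /dzE ->].
Qed.

(** The tangent vectors at (a, b, t) correspond bijectively to the velocities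
(t u + u5 a, t u4 + u5 b) of the point (t a, t b) of R^4, because a is a unit
vector orthogonal to u and t > 0. This transports lderiv_ker to the degeneracy
of Exp_i. *)
Lemma degenerate_iff i a1 a2 a3 b t
    (s := t ^+ 2 * (so2_speed i a2 b ^+ 2 + a2 ^+ 2 - 1)) :
  unit_sphere a1 a2 a3 -> 0 < t ->
  degenerate i a1 a2 a3 b t <->
  (1 - a2 ^+ 2) * (F 3 s - 2 * F 4 s) = 0.
Proof.
move=> sph t_gt0; have t0 : t != 0 by rewrite gt_eqF.
transitivity (((t * a1) ^+ 2 + (t * a3) ^+ 2) * (F 3 s - 2 * F 4 s) = 0);
  last first.
  have -> : (t * a1) ^+ 2 + (t * a3) ^+ 2 = t ^+ 2 * (1 - a2 ^+ 2).
    by rewrite -sph; ring.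
  rewrite -mulrA; split=> [/eqP|->]; last by rewrite mulr0.
  by rewrite mulf_eq0 expf_eq0 /= (negPf t0) => /eqP.
rewrite /s -(so21_sq_speed _ _ _ sph) -lderiv_ker; split.
  move=> [[[[[u1 u2] u3] u4] u5] [tg u0 /diff_Exp_eq0[dv e]]].
  exists (t * u1 + u5 * a1), (t * u3 + u5 * a3), (t * u4 + u5 * b); split=> //.
  apply: contraNneq u0 => -[d1 d3 d4].
  have u50 : u5 = 0.
    have : a1 * (t * u1 + u5 * a1) + a2 * (t * u2 + u5 * a2)
        + a3 * (t * u3 + u5 * a3) = 0.
      by rewrite d1 dv d3 !mulr0 !addr0.
    move=> <-; rewrite -[LHS]mulr1 -sph -[LHS]addr0 -(mulr0 t).
    rewrite -[in X in _ + X]tg.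
    by ring.
  have cancel0 u c : t * u + u5 * c = 0 -> u = 0.
    by rewrite u50 mul0r addr0 => /eqP; rewrite mulf_eq0 (negPf t0) => /eqP.
  by rewrite u50 (cancel0 _ _ d1) (cancel0 _ _ dv)
    (cancel0 _ _ d3) (cancel0 _ _ d4).
move=> [x' [y' [z' [n0 e]]]].
(* The radial component of (x', 0, y') along the unit vector a. *)
pose u5 := a1 * x' + a3 * y'.
have cancel_t c d : t * ((c - u5 * d) / t) + u5 * d = c by field.
exists ((x' - u5 * a1) / t, (0 - u5 * a2) / t, (y' - u5 * a3) / t,
        (z' - u5 * b) / t, u5); split.
- rewrite /tangent /=.
  transitivity ((u5 - u5 * (a1 ^+ 2 + a2 ^+ 2 + a3 ^+ 2)) / t).
    by rewrite /u5; field.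
  by rewrite sph mulr1 subrr mul0r.
- apply: contraNneq n0 => -[d1 _ d3 d4 d5].
  move: d1 d3 d4; rewrite d5 !mul0r !subr0 => d1 d3 d4.
  by rewrite -[x'](divfK t0) -[y'](divfK t0) -[z'](divfK t0) d1 d3 d4 !mul0r.
by apply/diff_Exp_eq0; rewrite !cancel_t.
Qed.

End Geodesics.

(** * Zeros of sin y (sin y - y cos y) *)

Section Roots.
Variable R : realType.
Implicit Types (y w : R) (m n k : nat).

(** It vanishes exactly where tan y = y, without the poles. *)
Definition tan_gap y : R := sin y - y * cos y.

Lemma tan_gap_shift m y : tan_gap (y + pi *+ m) =
  (-1) ^+ m * (sin y - (y + pi *+ m) * cos y).
Proof.
rewrite /tan_gap (alternatingn (@sinDpi R)) (alternatingn (@cosDpi R)).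
by rewrite mulrBr mulrCA.
Qed.

(** The derivative is (y + a) sin y. *)
Lemma tan_gap_shift_incr (a : R) : 0 <= a ->
  {in `[0, pi] &, {homo (fun y => sin y - (y + a) * cos y) : x y / x < y}}.
Proof.
move=> a_ge0; pose f (y : R) : R := sin y - (y + a) * cos y.
rewrite -[X in {homo X : _ _ / _ < _}]/f.
have df y : is_derive y (1 : R) f ((y + a) * sin y).
  rewrite /f; apply: is_derive_eq; rewrite /GRing.scale /= addr0; ring.
apply: gtr0_derive1_lt_cc.
- by move=> y _; have [] := df y.
- move=> y; rewrite in_itv /= => /andP[y_gt0 y_lt].
  rewrite derive1E (@derive_val _ _ _ _ _ _ _ (df y)).
  by rewrite mulr_gt0 ?sin_gt0_pi ?y_gt0 // ltr_wpDr.
- by apply: derivable_within_continuous => y _; have [] := df y.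
Qed.

Lemma tan_gap_neq0 y : 0 < y <= pi -> tan_gap y != 0.
Proof.
move=> /andP[y_gt0 y_le]; rewrite gt_eqF // /tan_gap.
have := @tan_gap_shift_incr 0 (lexx _) 0 y.
rewrite !in_itv /= !lexx pi_ge0 y_le (ltW y_gt0) => /(_ isT isT y_gt0).
by rewrite sin0 !addr0 mul0r subr0.
Qed.

(** Up to sign, tan_gap on the interval from a = (m + 1) pi to a + pi is the
increasing function of tan_gap_shift_incr, which runs from - a < 0 to a + pi. *)
Lemma tan_gap_root m : exists x, pi *+ m.+1 < x < pi *+ m.+2 /\
  forall y, pi *+ m.+1 <= y <= pi *+ m.+2 -> (tan_gap y = 0 <-> y = x).
Proof.
set a := pi *+ m.+1; pose f (y : R) : R := sin y - (y + a) * cos y.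
have a_gt0 : 0 < a by rewrite pmulrn_lgt0 ?pi_gt0.
have f_incr := tan_gap_shift_incr (ltW a_gt0).
have cf : {within `[0, pi], continuous f}.
  apply: continuous_subspaceT => y; apply: cvgB; first exact: continuous_sin.
  apply: cvgM; last exact: continuous_cos.
  by apply: cvgD; [exact: cvg_id | exact: cvg_cst].
have f0 : f 0 = - a by rewrite /f sin0 cos0 mulr1 !add0r.
have fpi : f pi = pi + a by rewrite /f sinpi cospi mulrN1 sub0r opprK.
have [|c c_in fc] := @IVT R f 0 pi 0 (pi_ge0 _) cf.
  rewrite f0 fpi ge_min le_max oppr_le0 (ltW a_gt0) /=.
  by apply/orP; right; rewrite addr_ge0 ?pi_ge0 ?ltW.
have f_inj y : y \in `[0, pi] -> f y = 0 -> y = c.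
  move=> y_in fy; apply/eqP; rewrite eq_le !leNgt.
  apply/andP; split; apply/negP.
  - by move=> /(f_incr _ _ c_in y_in); rewrite -/(f _) -/(f _) fc fy ltxx.
  - by move=> /(f_incr _ _ y_in c_in); rewrite -/(f _) -/(f _) fc fy ltxx.
have aS : pi *+ m.+2 = pi + a by rewrite mulrS.
have [c_ge0 c_le] : 0 <= c /\ c <= pi by move: c_in; rewrite in_itv => /andP.
exists (c + a); rewrite aS; split.
  rewrite ltrDr ltrD2r !lt_neqAle c_ge0 c_le !andbT; apply/andP; split.
    by apply/eqP => c0; move: fc; rewrite -c0 f0; lra.
  by apply/eqP => c0; move: fc pi_gt0; rewrite c0 fpi; lra.
move=> y /andP[ay ya].
have gapE : tan_gap y = (-1) ^+ m.+1 * f (y - a).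
  by rewrite -[in LHS](subrK a y) tan_gap_shift.
have -> : tan_gap y = 0 <-> f (y - a) = 0.
  rewrite gapE; split=> [/eqP|->]; last by rewrite mulr0.
  by rewrite mulf_eq0 signr_eq0 => /eqP.
split=> [fy|->]; last by rewrite addrK.
by rewrite -(f_inj (y - a)) ?subrK // in_itv /= subr_ge0 ay /=; lra.
Qed.

Lemma pi_interval y : 0 <= y -> exists m, pi *+ m <= y < pi *+ m.+1.
Proof.
move=> y_ge0; exists (Num.truncn (y / pi)).
have := truncn_itv (divr_ge0 y_ge0 (pi_ge0 R)).
by rewrite ler_pdivlMr ?ltr_pdivrMr ?pi_gt0 // !mulr_natl.
Qed.

Lemma tan_gap_roots : exists x : nat -> R,
  (forall m, pi *+ m.+1 < x m < pi *+ m.+2) /\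
  forall y, 0 < y -> (tan_gap y = 0 <-> exists m, y = x m).
Proof.
have [x xP] := choice tan_gap_root; exists x; split=> [m|y y_gt0].
  by have [] := xP m.
split=> [y0|[m ->]]; last first.
  by have [/andP[lt1 lt2] e] := xP m; apply/e => //; rewrite !ltW.
have [[|m] /andP[le1 lt2]] := pi_interval (ltW y_gt0).
  by have := @tan_gap_neq0 y; rewrite y_gt0 ltW // y0 eqxx => /(_ isT).
by exists m; have [_ e] := xP m; apply/e => //; rewrite le1 ltW.
Qed.

Lemma sin_eq0 y : 0 < y -> (sin y = 0 <-> exists m, y = pi *+ m.+1).
Proof.
move=> y_gt0; split=> [s0|[m ->]]; last first.
  by rewrite -[_ *+ _]add0r (alternatingn (@sinDpi R)) sin0 mulr0.
have [m /andP[le1 lt2]] := pi_interval (ltW y_gt0).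
have : sin (y - pi *+ m) = 0.
  move: s0; rewrite -{1}(subrK (pi *+ m) y) (alternatingn (@sinDpi R)) => /eqP.
  by rewrite mulf_eq0 signr_eq0 => /eqP.
have [ey|ny] := eqVneq y (pi *+ m).
  case: m ey {le1 lt2} => [|m] ey _; last by exists m.
  by move: y_gt0; rewrite ey ltxx.
suff /gt_eqF/eqP : 0 < sin (y - pi *+ m) by [].
apply: sin_gt0_pi; rewrite subr_gt0 lt_neqAle eq_sym ny le1 /=.
by rewrite ltrBlDr -mulrS.
Qed.

(** A strictly increasing enumeration lists a set in ascending order, the count
starting from 1 in is_nth and from 0 here. *)
Lemma is_nth_enum (S : set R) (z : nat -> R) :
  (forall n, z n < z n.+1) -> (forall s, S s <-> exists n, s = z n) ->
  forall n, is_nth S n.+1 (z n).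
Proof.
move=> z_incr SE n; split; first by apply/SE; exists n.
have z_lt := homo_ltn (@lt_trans _ _) z_incr.
have z_le m k : z m <= z k -> (m <= k)%N.
  by rewrite leqNgt; apply: contraTN => /z_lt; rewrite ltNge.
have z_inj : injective z.
  by move=> m k e; apply/eqP; rewrite eqn_leq !z_le // e.
rewrite (_ : [set s | _] = z @` `I_n.+1).
  by apply: inj_card_eq => m k _ _; exact: z_inj.
apply/seteqP; split=> [s [/SE[m ->] /z_le mn]|s [m mn <-]]; first by exists m.
split; first by apply/SE; exists m.
move: mn; rewrite /= ltnS leq_eqVlt => /predU1P[->//|/z_lt/ltW //].
Qed.

(** The merged sequence pi, x_0, 2 pi, x_1, ...: when x m lies between
(m + 1) pi and (m + 2) pi, it is increasing. *)
Definition conj_zeros (x : nat -> R) n : R :=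
  if odd n then x n./2 else pi *+ n./2.+1.

Lemma conj_zeros_incr x : (forall m, pi *+ m.+1 < x m < pi *+ m.+2) ->
  forall n, conj_zeros x n < conj_zeros x n.+1.
Proof.
move=> xP n; rewrite /conj_zeros /= uphalf_half.
by have /andP[] := xP n./2; case: odd.
Qed.

Lemma conj_zerosP x y : 0 < y ->
  (forall y, 0 < y -> (tan_gap y = 0 <-> exists m, y = x m)) ->
  sin y * tan_gap y = 0 <-> exists n, y = conj_zeros x n.
Proof.
move=> y_gt0 xP; split=> [/eqP|[n]].
  rewrite mulf_eq0 => /orP[/eqP|/eqP].
    move=> /(sin_eq0 y_gt0)[m ->].
    by exists m.*2; rewrite /conj_zeros odd_double doubleK.
  move=> /(xP _ y_gt0)[m ->].
  by exists m.*2.+1; rewrite /conj_zeros /= odd_double /= uphalf_double.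
rewrite /conj_zeros; case: odd => yE.
  by rewrite ((xP _ y_gt0).2 _) ?mulr0 //; exists n./2.
by rewrite ((sin_eq0 y_gt0).2 _) ?mul0r //; exists n./2.
Qed.

Lemma tan_rootsE y : tan_roots R y <-> 0 < y /\ tan_gap y = 0.
Proof.
split=> [[y_gt0 c0 ty]|[y_gt0 /eqP]].
  by split=> //; rewrite /tan_gap -{2}ty /tan divfK // subrr.
rewrite /tan_gap subr_eq0 => /eqP e.
have c0 : cos y != 0.
  apply/eqP => c0; have := cos2Dsin2 y; rewrite e c0 mulr0 expr0n addr0.
  by move/eqP; rewrite eq_sym oner_eq0.
by split=> //; rewrite /tan e mulfK.
Qed.
End Roots.

(** * Conjugate times *)

Section Locus.
Variable R : realType.
Implicit Types (i : metric) (a b t w x y z v s : R).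

Notation F := (@stumpff R).

Lemma w_E i a2 b :
  w_ i a2 b = Num.sqrt (so2_speed i a2 b ^+ 2 + a2 ^+ 2 - 1).
Proof. by case: i. Qed.

Lemma w_sqr i a2 b : 0 < w_ i a2 b ->
  so2_speed i a2 b ^+ 2 + a2 ^+ 2 - 1 = w_ i a2 b ^+ 2.
Proof. by rewrite w_E sqrtr_gt0 => h; rewrite sqr_sqrtr // ltW. Qed.

Lemma degenerate_w_gt0 i a1 a2 a3 b t (w := w_ i a2 b) :
  unit_sphere a1 a2 a3 -> a2 != 1 -> a2 != -1 -> 0 < w -> 0 < t ->
  degenerate i a1 a2 a3 b t <->
  sin (t * w / 2) * tan_gap (t * w / 2) = 0.
Proof.
move=> sph a2n1 a2nN1 w_gt0 t_gt0; set y := t * w / 2.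
have y_gt0 : 0 < y by rewrite !mulr_gt0 // invr_gt0.
have sE : t ^+ 2 * (so2_speed i a2 b ^+ 2 + a2 ^+ 2 - 1) = (2 * y) ^+ 2.
  by rewrite (w_sqr w_gt0) /y -/w; field.
rewrite (degenerate_iff i b sph t_gt0) sE.
have a2n : 1 - a2 ^+ 2 != 0.
  by rewrite subr_eq0 eq_sym sqrf_eq1 negb_or a2n1.
have e := stumpff3B4_sq y; have y4 : (2 * y) ^+ 4 != 0.
  by rewrite expf_neq0 // mulf_neq0 ?pnatr_eq0 ?gt_eqF.
split=> [/eqP|sy].
  rewrite mulf_eq0 (negPf a2n) => /eqP h; move: e; rewrite h mulr0 => /esym/eqP.
  by rewrite mulf_eq0 pnatr_eq0 => /eqP.
apply/eqP; rewrite mulf_eq0; apply/orP; right; apply/eqP/(mulfI y4).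
by rewrite e mulr0 -/(tan_gap y) sy mulr0.
Qed.

Lemma not_degenerate_w_le0 i a1 a2 a3 b t :
  unit_sphere a1 a2 a3 -> a2 != 1 -> a2 != -1 -> ~~ (0 < w_ i a2 b) -> 0 < t ->
  ~ degenerate i a1 a2 a3 b t.
Proof.
move=> sph a2n1 a2nN1; rewrite w_E sqrtr_gt0 -leNgt => w_le0 t_gt0.
have a2n : 1 - a2 ^+ 2 != 0.
  by rewrite subr_eq0 eq_sym sqrf_eq1 negb_or a2n1.
move/(degenerate_iff i b sph t_gt0)/eqP; rewrite mulf_eq0 (negPf a2n) /=.
apply/negP; rewrite gt_eqF // stumpff3B4_gt0 //.
by rewrite mulr_ge0_le0 // exprn_ge0 // ltW.
Qed.

(** For a2 = 1 or a2 = -1 the curve is exp (t e2) or exp (- t e2), whatever b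
is, since e2 and e4 commute. *)
Lemma degenerate_a2_sqr1 i a1 a2 a3 b t :
  unit_sphere a1 a2 a3 -> 0 < t -> a2 ^+ 2 = 1 -> degenerate i a1 a2 a3 b t.
Proof.
by move=> sph t_gt0 a21; apply/degenerate_iff => //; rewrite a21 subrr mul0r.
Qed.

Lemma conj_times_enum (x : nat -> R) i a1 a2 a3 b (w := w_ i a2 b) :
  (forall y, 0 < y -> (tan_gap y = 0 <-> exists m, y = x m)) ->
  unit_sphere a1 a2 a3 -> a2 != 1 -> a2 != -1 -> 0 < w ->
  (forall n, 0 < conj_zeros x n) ->
  forall t, conj_times i a1 a2 a3 b t <-> exists n, t = 2 * conj_zeros x n / w.
Proof.
move=> xP sph a2n1 a2nN1 w_gt0 z_gt0 t; have w0 : w != 0 by rewrite gt_eqF.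
split=> [[t_gt0]|[n tE]].
  move=> /(degenerate_w_gt0 sph a2n1 a2nN1 w_gt0 t_gt0).
  have y_gt0 : 0 < t * w / 2 by rewrite !mulr_gt0 // invr_gt0.
  by move=> /(conj_zerosP y_gt0 xP)[n zE]; exists n; rewrite -zE -/w; field.
have t_gt0 : 0 < t by rewrite tE !mulr_gt0 ?invr_gt0.
split=> //; apply/degenerate_w_gt0 => //.
have y_gt0 : 0 < t * w / 2 by rewrite !mulr_gt0 // invr_gt0.
by apply/(conj_zerosP y_gt0 xP); exists n; rewrite tE; field.
Qed.

Lemma first_conj_time_w i a1 a2 a3 b (w := w_ i a2 b) :
  unit_sphere a1 a2 a3 -> a2 != 1 -> a2 != -1 -> 0 < w ->
  first_conj_time i a1 a2 a3 b = (2 * pi / w)%:E.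
Proof.
move=> sph a2n1 a2nN1 w_gt0; have w0 : w != 0 by rewrite gt_eqF.
have t_gt0 : 0 < 2 * pi / w by rewrite !mulr_gt0 ?invr_gt0 ?pi_gt0.
apply/eqP; rewrite eq_le; apply/andP; split.
  apply: ereal_inf_lbound; exists (2 * pi / w) => //; split=> //.
  apply/degenerate_w_gt0 => //.
  by rewrite -/w (_ : 2 * pi / w * w / 2 = pi) ?sinpi ?mul0r //; field.
apply/ereal_infP => _ [t [{}t_gt0 deg] <-]; rewrite lee_fin leNgt.
apply/negP => t_lt.
have /eqP := (degenerate_w_gt0 sph a2n1 a2nN1 w_gt0 t_gt0).1 deg.
have y_gt0 : 0 < t * w_ i a2 b / 2 by rewrite !mulr_gt0 // invr_gt0.
have y_lt : t * w_ i a2 b / 2 < pi.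
  by rewrite ltr_pdivrMr // -ltr_pdivlMr // [pi * 2]mulrC.
rewrite mulf_eq0 gt_eqF ?sin_gt0_pi ?y_gt0 //=.
by apply/negP/tan_gap_neq0; rewrite y_gt0 ltW.
Qed.

Lemma first_conj_time_finite i a1 a2 a3 b t : unit_sphere a1 a2 a3 -> 0 < t ->
  first_conj_time i a1 a2 a3 b = t%:E ->
  [/\ a2 != 1, a2 != -1 & 0 < w_ i a2 b].
Proof.
move=> sph t_gt0 tE.
have a2n : a2 ^+ 2 != 1.
  apply/eqP => a21; suff : (t%:E <= (t / 2)%:E)%E by rewrite lee_fin; lra.
  rewrite -tE; apply: ereal_inf_lbound; exists (t / 2) => //.
  by split; [lra | apply: degenerate_a2_sqr1 => //; lra].
have [a2n1 a2nN1] : a2 != 1 /\ a2 != -1.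
  by move: a2n; rewrite sqrf_eq1 negb_or => /andP.
split=> //; apply: contraT => w_le0.
suff : first_conj_time i a1 a2 a3 b = +oo%E by rewrite tE.
rewrite /first_conj_time (_ : conj_times _ _ _ _ _ = set0).
  by rewrite image_set0 ereal_inf0.
apply/seteqP; split=> // s [s_gt0 deg].
exact: (not_degenerate_w_le0 sph a2n1 a2nN1 w_le0 s_gt0 deg).
Qed.

End Locus.

(** * The first conjugate locus *)

Section Locus.
Variable R : realType.
Implicit Types (i : metric) (a b t w x y z v s psi : R).

Notation F := (@stumpff R).

Lemma cexp_so2 z v : cexp 0 0 z v = elt (rotation z) v.
Proof.
have zF : z * F 1 (z ^+ 2) = sin z := stumpff1_sq z.
have zG : 1 - z ^+ 2 * F 2 (z ^+ 2) = cos z.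
  by rewrite -stumpff0_sq (stumpff_rec 0) fact0 invr1.
rewrite cexpE E4E /elt /so21_sq expr0n !subr0.
apply/matrixP => k l; have [k' ->|k' ->] := @split_ordP 3 1 k;
  have [l' ->|l' ->] := @split_ordP 3 1 l.
- rewrite [RHS](@block_mxEul R 3 1 3 1) !mxE !big_ord_recl !big_ord0 !mxE.
  rewrite -zF -zG.
  case: k' l' => -[|[|[|?]]] //= ? [[|[|[|?]]] //= ?]; ring.
- rewrite [RHS](@block_mxEur R 3 1 3 1) !mxE !big_ord_recl !big_ord0 !mxE.
  case: k' l' => -[|[|[|?]]] //= ? [[|?] //= ?]; ring.
- rewrite [RHS](@block_mxEdl R 3 1 3 1) !mxE !big_ord_recl !big_ord0 !mxE.
  case: k' l' => -[|?] //= ? [[|[|[|?]]] //= ?]; ring.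
- rewrite [RHS](@block_mxEdr R 3 1 3 1) !mxE !big_ord_recl !big_ord0 !mxE.
  case: k' l' => -[|?] //= ? [[|?] //= ?]; ring.
Qed.

Lemma SO21_rotation psi : SO21 R (rotation psi).
Proof.
have cs := cos2Dsin2 psi.
split; last split.
- apply/matrixP => k l; rewrite /J21 !mxE !big_ord_recl !big_ord0 !mxE.
  rewrite !big_ord_recl !big_ord0 !mxE.
  case: k l => -[|[|[|?]]] //= ? [[|[|[|?]]] //= ?]; try ring.
  + by rewrite -[RHS]cs; ring.
  + by rewrite -[RHS]cs; ring.
- by rewrite det_mx33 !mxE !inordK //= -[RHS]cs; ring.
- by rewrite mxE.
Qed.

(** A zero of both sin and 1 - cos: F_1 and F_2 vanish at (2 pi)^2. *)
Lemma cexp_full_turn x y z v : so21_sq x y z = (2 * pi) ^+ 2 ->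
  cexp x y z v = 1 + (expR v - 1) *: E4 R.
Proof.
have pi2 : 2 * pi != 0 :> R by rewrite mulf_neq0 ?pnatr_eq0 ?gt_eqF ?pi_gt0.
have twopi : 2 * pi = pi *+ 2 :> R by rewrite mulr_natl.
rewrite cexpE => ->.
have -> : F 1 ((2 * pi) ^+ 2) = 0.
  by apply: (mulfI pi2); rewrite stumpff1_sq twopi sin2pi mulr0.
have -> : F 2 ((2 * pi) ^+ 2) = 0.
  have /eqP := stumpff_rec 0 ((2 * pi) ^+ 2 : R).
  rewrite stumpff0_sq {1}twopi cos2pi fact0 invr1 -subr_eq0 opprB addrCA subrr.
  by rewrite addr0 mulf_eq0 expf_eq0 (negPf pi2) => /eqP.
by rewrite !scale0r !addr0.
Qed.

Lemma geodesic_first_conj i a1 a2 a3 b (w := w_ i a2 b) (t := 2 * pi / w) :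
  unit_sphere a1 a2 a3 -> 0 < w ->
  geodesic i a1 a2 a3 b t = elt (rotation (- (t * b))) (t * a2).
Proof.
move=> sph w_gt0; rewrite geodesicE cexp_full_turn; last first.
  rewrite so21_sq_speed // (w_sqr w_gt0) -/w /t.
  by field; rewrite gt_eqF.
rewrite -cexp_so2 !cexpE expR0 subrr scale0r addr0.
move: (F 1 _) (F 2 _) (expR _ - 1) => f g c; move: (- (t * b)) => z.
rewrite mulrDl mul1r -scalerAl !mulrDr mulr1 -!scalerAr.
rewrite [E4 R * (_ * _)]mulrA E4_so21mx mul0r.
by rewrite !scaler0 !addr0.
Qed.

(** With c = t * so2_speed i a2 b and v = t a2, the requirement t = 2 pi / w_i
reads t^2 = c^2 + v^2 - (2 pi)^2, and |a2| < 1 reads t^2 > v^2; so any c with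
|c| > 2 pi yields a solution. The angle theta = - t b determines c, and
|c| > 2 pi is achieved for both metrics by adding sufficiently many full turns
to psi. *)
Lemma first_conj_surj i psi v : exists a1 a2 a3 b t,
  [/\ unit_sphere a1 a2 a3, a2 != 1, a2 != -1 & 0 < w_ i a2 b] /\
  [/\ 0 < t, t = 2 * pi / w_ i a2 b, t * a2 = v
    & rotation (- (t * b)) = rotation psi].
Proof.
(* A full turn has length at least 1, so n of them exceed the bound. *)
pose n := Num.bound (`|v| + `|psi| + 2 * pi).
pose theta : R := psi + pi *+ 2 *+ n.
have theta_gt : 2 * pi + `|v| < theta.
  have : `|v| + `|psi| + 2 * pi < n%:R.
    by apply: archi_boundP; rewrite !addr_ge0 ?mulr_ge0 ?pi_ge0.
  have : n%:R <= pi *+ 2 *+ n :> R.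
    by rewrite -[leRHS]mulr_natl ler_peMr // mulr2n; have := pi_ge2 R; lra.
  by rewrite /theta; have := ler_norm (- psi); rewrite normrN; lra.
(* c will be T * so2_speed i a2 b. *)
pose c : R := if i is rho1 then v - theta else - theta.
have c_lt : c < - (2 * pi).
  rewrite /c; case: (i); first by have := ler_norm v; lra.
  by have := normr_ge0 v; lra.
have pi0 := pi_gt0 R.
have T2_gt : v ^+ 2 < c ^+ 2 + v ^+ 2 - (2 * pi) ^+ 2 by nra.
pose T := Num.sqrt (c ^+ 2 + v ^+ 2 - (2 * pi) ^+ 2).
have T2 : T ^+ 2 = c ^+ 2 + v ^+ 2 - (2 * pi) ^+ 2.
  by rewrite sqr_sqrtr // (le_trans (sqr_ge0 v)) // ltW.
have T_gt0 : 0 < T by rewrite sqrtr_gt0 (le_lt_trans (sqr_ge0 v)).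
have T0 : T != 0 by rewrite gt_eqF.
pose a2 := v / T; pose b := - theta / T.
have a2_lt : a2 ^+ 2 < 1.
  by rewrite /a2 expr_div_n ltr_pdivrMr ?exprn_gt0 // mul1r T2.
have [a2n1 a2nN1] : a2 != 1 /\ a2 != -1.
  by apply/andP; rewrite -negb_or -sqrf_eq1 lt_eqF.
have wE : w_ i a2 b = 2 * pi / T.
  rewrite w_E (_ : _ - 1 = (2 * pi / T) ^+ 2).
    by rewrite sqrtr_sqr ger0_norm // !mulr_ge0 ?invr_ge0 ?pi_ge0 // ltW.
  have -> : so2_speed i a2 b = c / T.
    by rewrite /so2_speed /c /a2 /b; case: (i); rewrite // mulrDl mulNr.
  apply: (mulIf (expf_neq0 2 T0)); rewrite /a2.
  have -> : ((c / T) ^+ 2 + (v / T) ^+ 2 - 1) * T ^+ 2 =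
      c ^+ 2 + v ^+ 2 - T ^+ 2.
    by field.
  by rewrite {1}T2; field.
exists (Num.sqrt (1 - a2 ^+ 2)), a2, 0, b, T; split; split=> //.
- by rewrite /unit_sphere sqr_sqrtr ?subr_ge0 ?ltW //; ring.
- by rewrite wE !mulr_gt0 ?invr_gt0.
- by rewrite wE invfM invrK mulVKf // mulf_neq0 ?pnatr_eq0 ?gt_eqF.
- by rewrite /a2 mulrC divfK.
have -> : - (T * b) = theta by rewrite /b; field.
rewrite /rotation /theta (periodicn (@sinD2pi R)) (periodicn (@cosD2pi R)).
by [].
Qed.

End Locus.

Theorem corollary2 (R : realType) :
  (exists x : nat -> R,
     (forall m : nat, (0 < m)%N -> is_nth (tan_roots R) m (x m)) /\
     (forall (i : metric) (a1 a2 a3 b : R),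
        unit_sphere a1 a2 a3 -> a2 != 1 -> a2 != -1 -> 0 < w_ i a2 b ->
        forall m : nat, (0 < m)%N ->
          is_nth (conj_times i a1 a2 a3 b) (2 * m - 1)%N
                 (2 * pi * m%:R / w_ i a2 b) /\
          is_nth (conj_times i a1 a2 a3 b) (2 * m)%N
                 (2 * x m / w_ i a2 b))) /\
  (forall i : metric,
     conj_locus R i =
       [set g | exists (C : 'M[R]_3) (v psi : R),
          [/\ SO21 R C, C = rotation psi & g = elt C v]]).
Proof.
split.
  have [x [x_itv xP]] := tan_gap_roots R.
  have x_gt0 m : 0 < x m.
    have /andP[+ _] := x_itv m.
    by apply: lt_trans; rewrite pmulrn_lgt0 ?pi_gt0.
  (* The enumeration x starts at 0, the numbering of the roots at 1. *)
  exists (fun m => x m.-1); split.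
    move=> [//|m] _ /=.
    apply: is_nth_enum => [n|y].
      have /andP[_ lt1] := x_itv n; have /andP[lt2 _] := x_itv n.+1.
      exact: lt_trans lt1 lt2.
    split=> [/tan_rootsE[y_gt0 /(xP _ y_gt0)] //|[k ->]].
    by apply/tan_rootsE; split=> //; apply/xP => //; exists k.
  move=> i a1 a2 a3 b sph n1 nN1 w_gt0 [//|m] _.
  have z_incr := conj_zeros_incr x_itv.
  have z_gt0 n : 0 < conj_zeros x n.
    by rewrite /conj_zeros; case: odd; rewrite // pmulrn_lgt0 ?pi_gt0.
  have times n : is_nth (conj_times i a1 a2 a3 b) n.+1
      (2 * conj_zeros x n / w_ i a2 b).
    apply: (is_nth_enum _ (conj_times_enum xP sph n1 nN1 w_gt0 z_gt0)) => k.
    by rewrite ltr_pM2r ?invr_gt0 // ltr_pM2l.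
  split.
    have -> : (2 * m.+1 - 1 = m.*2.+1)%N by lia.
    have -> : 2 * pi * m.+1%:R / w_ i a2 b = 2 * conj_zeros x m.*2 / w_ i a2 b.
      by rewrite /conj_zeros odd_double doubleK -[2 * pi * _]mulrA mulr_natr.
    exact: times.
  have -> : (2 * m.+1 = m.*2.+2)%N by lia.
  have -> : x m.+1.-1 = conj_zeros x m.*2.+1.
    by rewrite /conj_zeros /= odd_double /= uphalf_double.
  exact: times.
move=> i; apply/seteqP; split=> g.
  move=> [a1 [a2 [a3 [b [t [sph t_gt0 tE ->]]]]]].
  have [n1 nN1 w_gt0] := first_conj_time_finite sph t_gt0 tE.
  move: tE; rewrite first_conj_time_w // => -[<-].
  exists (rotation (- (2 * pi / w_ i a2 b * b))), (2 * pi / w_ i a2 b * a2).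
  exists (- (2 * pi / w_ i a2 b * b)); split=> //; first exact: SO21_rotation.
  exact: geodesic_first_conj.
move=> [_ [v [psi [_ -> ->]]]].
have [a1 [a2 [a3 [b [t [[sph n1 nN1 w_gt0] [t_gt0 tE <- <-]]]]]]] :=
  first_conj_surj i psi v.
exists a1, a2, a3, b, t; split=> //.
  by rewrite first_conj_time_w // -tE.
by rewrite tE geodesic_first_conj.
Qed.
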